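(* There exists a recursive coloring function $c:\mathbb{N}\rightarrow \{0,1\}^3$ such that no infinite $\Pi^0_3$ set $A\subseteq\mathbb{N}$ is a solution to $c$ for Hindman's theorem, i.e. for every infinite $\Pi^0_3$ set $A$, the set $FS(A)$ is not monochromatic under $c$.
   Context: For a set $H\subseteq\mathbb{N}$, $FS(H)=\{\sum_{x\in F}x : F\subseteq H,\ F \text{ finite and nonempty}\}$. A set $H$ is a solution to a coloring $c$ for Hindman's theorem if $H$ is infinite and $FS(H)$ is monochromatic under $c$. *)

(* Defs.v *)
From mathcomp Require Import all_boot.
Set Implicit Arguments. Unset Strict Implicit. Unset Printing Implicit Defensive.

Inductive rcode : Type :=
| RZero : rcode
| RSucc : rcode
| RProj : nat -> rcode
| RComp : rcode -> list rcode -> rcode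
| RPrim : rcode -> rcode -> rcode
| RMin  : rcode -> rcode.

Inductive reval : rcode -> list nat -> nat -> Prop :=
| ev_zero v : reval RZero v 0
| ev_succ x v : reval RSucc (x :: v) x.+1
| ev_proj i v : i < size v -> reval (RProj i) v (nth 0 v i)
| ev_comp f gs v ys y :
    revals gs v ys -> reval f ys y -> reval (RComp f gs) v y
| ev_prim0 f g v y : reval f v y -> reval (RPrim f g) (0 :: v) y
| ev_primS f g n v r y :
    reval (RPrim f g) (n :: v) r -> reval g (n :: r :: v) y ->
    reval (RPrim f g) (n.+1 :: v) y
| ev_min f v n :
    reval f (n :: v) 0 ->
    (forall m, m < n -> exists k, reval f (m :: v) k.+1) ->
    reval (RMin f) v n
with revals : list rcode -> list nat -> list nat -> Prop :=
| evs_nil v : revals nil v nil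
| evs_cons g gs v y ys :
    reval g v y -> revals gs v ys -> revals (g :: gs) v (y :: ys).

Definition code3 (c : bool * bool * bool) : nat :=
  let: (a, b, d) := c in 4 * a + 2 * b + d.

Definition recursive_coloring (c : nat -> bool * bool * bool) : Prop :=
  exists e : rcode, forall n, reval e [:: n] (code3 (c n)).

Definition recursive_rel4 (R : nat -> nat -> nat -> nat -> bool) : Prop :=
  exists e : rcode, forall n x y z, reval e [:: n; x; y; z] (nat_of_bool (R n x y z)).

Definition Pi03 (A : nat -> Prop) : Prop :=
  exists R, recursive_rel4 R /\
    forall n, A n <-> (forall x, exists y, forall z, R n x y z).

Definition infinite_set (A : nat -> Prop) : Prop :=
  forall m, exists n, m <= n /\ A n.

(* FS(H): sums of finite nonempty subsets of H (a finite subset is given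
   as a duplicate-free nonempty list). *)
Definition FS (H : nat -> Prop) (s : nat) : Prop :=
  exists F : seq nat, [/\ F != [::], uniq F, (forall x, x \in F -> H x) &
                        s = \sum_(x <- F) x].

Definition monochromatic (c : nat -> bool * bool * bool) (S : nat -> Prop) : Prop :=
  exists col, forall s, S s -> c s = col.

Definition hindman_solution (c : nat -> bool * bool * bool) (H : nat -> Prop) : Prop :=
  infinite_set H /\ monochromatic c (FS H).

(* Main.v *)
Require Import Defs.
From mathcomp Require Import all_boot zify.
From Stdlib Require Import Classical.
Set Implicit Arguments. Unset Strict Implicit. Unset Printing Implicit Defensive.

(** Write numbers in base 2, let [lam n] and [mu n] be the lowest and the highest
    exponent of [n], and call two consecutive exponents of [n] a gap. The first two
    bits of the colour of [n] are the parities of [lam n] and [mu n]. If [FS A] is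
    monochromatic, then adding two elements of [A] shows that at most two of them
    share a value of [lam] and no two share a value of [mu]; in particular elements
    of [A] far out are apart from a given one.

    The third bit is the parity of the sum, over the gaps [(m, b)] of [n], of weights
    [gap_weight l m b t] with [l = lam n] and [t = mu n]. For [X << w << x << v] (each
    far below the next) this sum splits, so equality of the colours of [X + w + x + v]
    and [X + w + v] is an equation between the weights of the gaps [(mu w, lam x)],
    [(mu x, lam v)], [(mu w, lam v)] and the inner weight [G] of [x]. It fails as soon
    as the weight of [(mu w, b)] is [1 + G w] for the elements [w] of [A] and large [b].

    So the weight at [(m, b)] has to find the element of [A] whose highest exponent
    is [m]. There is at most one, and [A] is co-r.e. in the second jump of 0, hence it
    is the last survivor of its row [2^m, 2^(m+1)): two nested limits ([b] and [t])
    suffice. The value [l] tells which Pi03 set is being treated: the [e]-th one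
    reserves [lam X] for the least [X] surviving to level [m] whose [lam] is not
    reserved by an earlier set; for large [m] this is one of finitely many elements of
    [A], so one of them serves infinitely many [w]. *)

(** * Primitive recursive functions *)

(** The newest variable is the last component and becomes the head of the vector under [flat]. A
    binder thus leads from [ctx k] to [ctx k.+1], and closure lemmas apply to open Rocq terms. *)
Fixpoint ctx (k : nat) : Type := if k is k'.+1 then (ctx k' * nat)%type else unit.

Fixpoint flat (k : nat) : ctx k -> seq nat :=
  if k is k'.+1 then fun c => c.2 :: flat c.1 else fun=> [::].

Definition cpt k (f : ctx k -> nat) : Prop :=
  exists e, forall c, reval e (flat c) (f c).

Definition cpts k m (s : ctx k -> ctx m) : Prop :=
  exists gs, forall c, revals gs (flat c) (flat (s c)).

Lemma cpt_ext k (f g : ctx k -> nat) : f =1 g -> cpt f -> cpt g.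
Proof. by move=> fg [e He]; exists e => c; rewrite -fg. Qed.

Lemma cpt_subst k m (s : ctx k -> ctx m) (f : ctx m -> nat) :
  cpts s -> cpt f -> cpt (fun c => f (s c)).
Proof. by move=> [gs Hgs] [e He]; exists (RComp e gs) => c; apply: ev_comp (He _). Qed.

Lemma cpts_nil k : cpts (fun _ : ctx k => (tt : ctx 0)).
Proof. by exists [::] => c; constructor. Qed.

Lemma cpts_cons k m (s : ctx k -> ctx m) (f : ctx k -> nat) :
  cpts s -> cpt f -> cpts (fun c => ((s c, f c) : ctx m.+1)).
Proof. by move=> [gs Hgs] [e He]; exists (e :: gs) => c; constructor. Qed.

Lemma size_flat k (c : ctx k) : size (flat c) = k.
Proof. by elim: k c => //= k IH c; rewrite IH. Qed.

Lemma revals_proj (v : seq nat) i :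
  i <= size v -> revals (map RProj (iota i (size v - i))) v (drop i v).
Proof.
move=> iv; move: {2}(size v - i) (erefl (size v - i)) => j.
elim: j i iv => [|j IH] i iv E; rewrite E.
  by move/eqP: E; rewrite subn_eq0 => E; rewrite drop_oversize //; constructor.
have lt : i < size v by rewrite -subn_gt0 E.
rewrite (drop_nth 0) //=; constructor; first by constructor.
have Ej : size v - i.+1 = j by rewrite subnS E.
by rewrite -Ej; apply: IH.
Qed.

Lemma cpts_id k : cpts (fun c : ctx k => c).
Proof.
exists (map RProj (iota 0 k)) => c.
by have := @revals_proj (flat c) 0 isT; rewrite size_flat subn0 drop0.
Qed.

Lemma cpts_fst k : cpts (fun c : ctx k.+1 => c.1 : ctx k).
Proof.
exists (map RProj (iota 1 k)) => c.
by have := @revals_proj (flat c) 1 isT; rewrite size_flat subn1 /= drop0.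
Qed.

Lemma cpts_comp k m p (s : ctx k -> ctx m) (r : ctx m -> ctx p) :
  cpts s -> cpts r -> cpts (fun c => r (s c)).
Proof.
move=> [g1 H1] [g2 H2]; exists [seq RComp g g1 | g <- g2] => c.
move: (flat (r (s c))) (H2 (s c)) => w.
elim: g2 w {H2} => [|g gs IH] w E; inversion E; subst; first by constructor.
by constructor; [apply: ev_comp (H1 c) _ | apply: IH].
Qed.

Lemma cpt_weak k (f : ctx k -> nat) : cpt f -> cpt (fun c : ctx k.+1 => f c.1).
Proof. exact/cpt_subst/cpts_fst. Qed.

Lemma cpt_var k : cpt (fun c : ctx k.+1 => c.2).
Proof. by exists (RProj 0) => c; exact: (@ev_proj 0 (flat c)). Qed.

Lemma cpt_app1 (h : nat -> nat) : cpt (fun c : ctx 1 => h c.2) ->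
  forall k (f : ctx k -> nat), cpt f -> cpt (fun c => h (f c)).
Proof.
move=> Hh k f Hf.
exact: (cpt_subst (cpts_cons (cpts_nil k) Hf) Hh).
Qed.

Lemma cpt_app2 (h : nat -> nat -> nat) : cpt (fun c : ctx 2 => h c.1.2 c.2) ->
  forall k (f g : ctx k -> nat), cpt f -> cpt g -> cpt (fun c => h (f c) (g c)).
Proof.
move=> Hh k f g Hf Hg.
exact: (cpt_subst (cpts_cons (cpts_cons (cpts_nil k) Hf) Hg) Hh).
Qed.

Lemma cpt_app3 (h : nat -> nat -> nat -> nat) :
  cpt (fun c : ctx 3 => h c.1.1.2 c.1.2 c.2) ->
  forall k (f1 f2 f3 : ctx k -> nat), cpt f1 -> cpt f2 -> cpt f3 ->
  cpt (fun c => h (f1 c) (f2 c) (f3 c)).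
Proof.
move=> Hh k f1 f2 f3 H1 H2 H3.
exact: (cpt_subst (cpts_cons (cpts_cons (cpts_cons (cpts_nil k) H1) H2) H3) Hh).
Qed.

Lemma cpt_app4 (h : nat -> nat -> nat -> nat -> nat) :
  cpt (fun c : ctx 4 => h c.1.1.1.2 c.1.1.2 c.1.2 c.2) ->
  forall k (f1 f2 f3 f4 : ctx k -> nat), cpt f1 -> cpt f2 -> cpt f3 -> cpt f4 ->
  cpt (fun c => h (f1 c) (f2 c) (f3 c) (f4 c)).
Proof.
move=> Hh k f1 f2 f3 f4 H1 H2 H3 H4.
exact: (cpt_subst (cpts_cons (cpts_cons (cpts_cons (cpts_cons (cpts_nil k)
  H1) H2) H3) H4) Hh).
Qed.

Lemma cpt_app5 (h : nat -> nat -> nat -> nat -> nat -> nat) :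
  cpt (fun c : ctx 5 => h c.1.1.1.1.2 c.1.1.1.2 c.1.1.2 c.1.2 c.2) ->
  forall k (f1 f2 f3 f4 f5 : ctx k -> nat),
  cpt f1 -> cpt f2 -> cpt f3 -> cpt f4 -> cpt f5 ->
  cpt (fun c => h (f1 c) (f2 c) (f3 c) (f4 c) (f5 c)).
Proof.
move=> Hh k f1 f2 f3 f4 f5 H1 H2 H3 H4 H5.
exact: (cpt_subst (cpts_cons (cpts_cons (cpts_cons (cpts_cons (cpts_cons
  (cpts_nil k) H1) H2) H3) H4) H5) Hh).
Qed.

Lemma cpt_succ k (f : ctx k -> nat) : cpt f -> cpt (fun c => (f c).+1).
Proof. by apply: (cpt_app1 (h := S)); exists RSucc => c; constructor. Qed.

Lemma cpt_const k n : cpt (fun _ : ctx k => n).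
Proof. elim: n => [|n]; [by exists RZero => c; constructor | exact: cpt_succ]. Qed.

Lemma cpt_iteri k (g : ctx k -> nat -> nat -> nat) (f B : ctx k -> nat) :
  cpt (fun d : ctx k.+2 => g d.1.1 d.2 d.1.2) -> cpt f -> cpt B ->
  cpt (fun c => iteri (B c) (g c) (f c)).
Proof.
move=> [eg Hg] [ef Hf] HB.
have [gs Hgs] := cpts_cons (cpts_id k) HB.
exists (RComp (RPrim ef eg) gs) => c; apply: ev_comp (Hgs c) _.
rewrite /=; elim: (B c) => [|n IH] /=; first by constructor.
by apply: ev_primS IH _; apply: (Hg ((c, _), n)).
Qed.

Lemma cpt_pred k (f : ctx k -> nat) : cpt f -> cpt (fun c => (f c).-1).
Proof.
apply: (cpt_app1 (h := predn)).
apply: (@cpt_ext _ (fun c : ctx 1 => iteri c.2 (fun i _ => i) 0)).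
  by move=> c; case: (c.2).
apply: (cpt_iteri (g := fun _ i _ => i)); [exact: cpt_var | exact: cpt_const | exact: cpt_var].
Qed.

Lemma cpt_add k (f g : ctx k -> nat) : cpt f -> cpt g -> cpt (fun c => f c + g c).
Proof.
move=> Hf Hg; apply: (@cpt_ext _ (fun c => iteri (f c) (fun _ r => r.+1) (g c))).
  by move=> c; elim: (f c) => //= n ->.
apply: (cpt_iteri (g := fun _ _ r => r.+1)) => //.
exact/cpt_succ/cpt_weak/cpt_var.
Qed.

Lemma cpt_mul k (f g : ctx k -> nat) : cpt f -> cpt g -> cpt (fun c => f c * g c).
Proof.
move=> Hf Hg; apply: (@cpt_ext _ (fun c => iteri (f c) (fun _ r => g c + r) 0)).
  by move=> c; elim: (f c) => //= n ->; rewrite mulSn.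
apply: (cpt_iteri (g := fun c _ r => g c + r)) => //; last exact: cpt_const.
by apply: cpt_add; [exact: (cpt_weak (cpt_weak Hg)) | exact: (cpt_weak (cpt_var _))].
Qed.

Lemma cpt_sub k (f g : ctx k -> nat) : cpt f -> cpt g -> cpt (fun c => f c - g c).
Proof.
move=> Hf Hg; apply: (@cpt_ext _ (fun c => iteri (g c) (fun _ r => r.-1) (f c))).
  by move=> c; elim: (g c) => [|n IH] /=; rewrite ?subn0 // IH subnS.
apply: (cpt_iteri (g := fun _ _ r => r.-1)) => //.
exact/cpt_pred/cpt_weak/cpt_var.
Qed.

Definition cptb k (P : ctx k -> bool) : Prop := cpt (fun c => nat_of_bool (P c)).

Lemma cpt_if k (P : ctx k -> bool) (f g : ctx k -> nat) :
  cptb P -> cpt f -> cpt g -> cpt (fun c => if P c then f c else g c).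
Proof.
move=> HP Hf Hg.
apply: (@cpt_ext _ (fun c => P c * f c + (1 - P c) * g c)).
  by move=> c; case: (P c); rewrite ?mul1n ?mul0n ?addn0.
by do !apply: cpt_add || apply: cpt_mul => //; apply: cpt_sub => //; exact: cpt_const.
Qed.

Lemma cptb_const k b : cptb (fun _ : ctx k => b).
Proof. exact: cpt_const. Qed.

Lemma cptb_neg k (P : ctx k -> bool) : cptb P -> cptb (fun c => ~~ P c).
Proof.
move=> HP; apply: (@cpt_ext _ (fun c => 1 - P c)); first by move=> c; case: (P c).
by apply: cpt_sub => //; exact: cpt_const.
Qed.

Lemma cptb_if k (P Q S : ctx k -> bool) :
  cptb P -> cptb Q -> cptb S -> cptb (fun c => if P c then Q c else S c).
Proof.
move=> HP HQ HS.
by apply: (@cpt_ext _ (fun c => if P c then Q c : nat else S c)) (cpt_if HP HQ HS) => c;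
  case: (P c).
Qed.

Lemma cptb_and k (P Q : ctx k -> bool) : cptb P -> cptb Q -> cptb (fun c => P c && Q c).
Proof. by move=> HP HQ; apply: cptb_if => //; exact: cpt_const. Qed.

Lemma cptb_or k (P Q : ctx k -> bool) : cptb P -> cptb Q -> cptb (fun c => P c || Q c).
Proof. by move=> HP HQ; apply: cptb_if => //; exact: cpt_const. Qed.

Lemma cptb_leq k (f g : ctx k -> nat) : cpt f -> cpt g -> cptb (fun c => f c <= g c).
Proof.
move=> Hf Hg; apply: (@cpt_ext _ (fun c => 1 - (f c - g c))).
  by move=> c; rewrite -subn_eq0; case: (f c - g c).
by do !apply: cpt_sub => //; exact: cpt_const.
Qed.

Lemma cptb_eq k (f g : ctx k -> nat) : cpt f -> cpt g -> cptb (fun c => f c == g c).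
Proof.
move=> Hf Hg; apply: (@cpt_ext _ (fun c => (f c <= g c) && (g c <= f c))).
  by move=> c; rewrite eqn_leq.
by apply: cptb_and; apply: cptb_leq.
Qed.

Lemma cptb_eqb k (P Q : ctx k -> bool) : cptb P -> cptb Q -> cptb (fun c => P c == Q c).
Proof.
move=> HP HQ; apply: (@cpt_ext _ (fun c => (P c : nat) == Q c)) (cptb_eq HP HQ) => c.
by case: (P c); case: (Q c).
Qed.

(** * Bounded quantifiers and bounded search *)

Definition bex n (P : nat -> bool) := has P (iota 0 n).
Definition ball n (P : nat -> bool) := all P (iota 0 n).
(* [bmin n P] is [n] when no [i < n] satisfies [P]. *)
Definition bmin n (P : nat -> bool) := find P (iota 0 n).

Lemma bexP n (P : nat -> bool) : reflect (exists2 i, i < n & P i) (bex n P).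
Proof.
apply: (iffP hasP) => -[i Hi Pi]; exists i => //; move: Hi; by rewrite mem_iota.
Qed.

Lemma ballP n (P : nat -> bool) : reflect (forall i, i < n -> P i) (ball n P).
Proof.
by apply: (iffP allP) => H i Hi; apply: H; move: Hi; rewrite mem_iota.
Qed.

Lemma bmin_sat n (P : nat -> bool) : bmin n P < n -> P (bmin n P).
Proof.
move=> lt; have := @nth_find _ 0 P (iota 0 n).
by rewrite has_find size_iota => /(_ lt); rewrite nth_iota.
Qed.

Lemma bmin_min n (P : nat -> bool) i : i < n -> P i -> bmin n P <= i.
Proof.
move=> lt Pi; rewrite leqNgt; apply/negP => lt'.
by have := before_find 0 lt'; rewrite nth_iota ?Pi.
Qed.

Lemma eq_bmin n (P Q : nat -> bool) : (forall i, i < n -> P i = Q i) -> bmin n P = bmin n Q.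
Proof.
move=> PQ; apply: eq_in_find => i; rewrite mem_iota => /andP[_]; exact: PQ.
Qed.

Lemma cptb_bex k (B : ctx k -> nat) (P : ctx k -> nat -> bool) :
  cpt B -> cptb (fun d : ctx k.+1 => P d.1 d.2) -> cptb (fun c => bex (B c) (P c)).
Proof.
move=> HB HP.
apply: (@cpt_ext _ (fun c => iteri (B c)
   (fun i r => (fun c i r => if P c i then 1 else r) c i r) 0)).
  move=> c; rewrite /bex; elim: (B c) => // n IH.
  rewrite iteriS IH -[in RHS]addn1 iotaD has_cat /= orbF orbC add0n.
  by case: (P c n).
apply: (cpt_iteri (g := fun c i r => if P c i then 1 else r)) => //; last exact: cpt_const.
apply: cpt_if; [|exact: cpt_const|exact: (cpt_weak (cpt_var _))].
exact: (cpt_subst (cpts_cons (cpts_comp (cpts_fst k.+1) (cpts_fst k)) (cpt_var _)) HP).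
Qed.

Lemma cptb_ball k (B : ctx k -> nat) (P : ctx k -> nat -> bool) :
  cpt B -> cptb (fun d : ctx k.+1 => P d.1 d.2) -> cptb (fun c => ball (B c) (P c)).
Proof.
move=> HB HP; apply: (@cpt_ext _ (fun c => ~~ bex (B c) (fun i => ~~ P c i))).
  by move=> c; rewrite /bex /ball -all_predC; congr (nat_of_bool _); apply: eq_all => i /=;
     rewrite negbK.
apply: cptb_neg; apply: (cptb_bex (P := fun c i => ~~ P c i)) => //; exact: cptb_neg.
Qed.

Lemma cpt_bmin k (B : ctx k -> nat) (P : ctx k -> nat -> bool) :
  cpt B -> cptb (fun d : ctx k.+1 => P d.1 d.2) -> cpt (fun c => bmin (B c) (P c)).
Proof.
move=> HB HP.
(* After [i] rounds the accumulator is the first witness below [i], or [i] if there is none, so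
   [r < i] says that the search has ended. *)
pose g (c : ctx k) i r := if r < i then r else if P c i then i else i.+1.
apply: (@cpt_ext _ (fun c => iteri (B c) (g c) 0)).
  move=> c; rewrite /bmin; elim: (B c) => // n IH.
  rewrite iteriS IH -[in RHS]addn1 iotaD find_cat size_iota /= add0n /g.
  by rewrite has_find size_iota; case: ltnP => //; case: (P c n) => _; rewrite ?addn0 ?addn1.
apply: (cpt_iteri (g := g)) => //; last exact: cpt_const.
have V0 := cpt_var k.+1; have V1 := cpt_weak (cpt_var k).
apply: cpt_if; [by apply: cptb_leq => //; exact: cpt_succ | done | ].
apply: cpt_if; [ | done | exact: cpt_succ].
exact: (cpt_subst (cpts_cons (cpts_comp (cpts_fst k.+1) (cpts_fst k)) V0) HP).
Qed.

Ltac cpt_leaf t d :=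
  first [ exact t
        | lazymatch d with S ?d' => let t' := uconstr:(cpt_weak t) in cpt_leaf t' d' end ].

(** Computability is proved by recursion on the syntax of the term; [cpt_user] and [cptb_user] are
    hooks, rebound as further functions are shown computable. *)
Ltac cpt_step :=
  lazymatch goal with
  | |- cptb (fun c => _ && _) => apply: cptb_and
  | |- cptb (fun c => _ || _) => apply: cptb_or
  | |- cptb (fun c => ~~ _) => apply: cptb_neg
  | |- cptb (fun c => if _ then _ else _) => apply: cptb_if
  | |- cptb (fun c => leq _ _) => apply: cptb_leq
  | |- cptb (fun c => @eq_op bool _ _) => apply: cptb_eqb
  | |- cptb (fun c => @eq_op nat _ _) => apply: cptb_eq
  | |- cptb (fun c => @eq_op _ _ _) => first [apply: cptb_eq | apply: cptb_eqb]
  | |- cptb (fun c => bex _ _) => apply: cptb_bex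
  | |- cptb (fun c => ball _ _) => apply: cptb_ball
  | |- cptb (fun c => true) => exact: cptb_const
  | |- cptb (fun c => false) => exact: cptb_const
  | |- cpt (fun c => addn _ _) => apply: cpt_add
  | |- cpt (fun c => muln _ _) => apply: cpt_mul
  | |- cpt (fun c => subn _ _) => apply: cpt_sub
  | |- cpt (fun c => S _) => apply: cpt_succ
  | |- cpt (fun c => predn _) => apply: cpt_pred
  | |- cpt (fun c => bmin _ _) => apply: cpt_bmin
  | |- cpt (fun c => if _ then _ else _) => apply: cpt_if
  | |- cpt (fun c => nat_of_bool _) => change_cptb
  | |- cpt (fun c => iteri _ _ _) => apply: cpt_iteri
  | |- cpt _ => first [ exact: cpt_const | cpt_user | let t := uconstr:(cpt_var _) in cpt_leaf t 12 ]
  | |- cptb _ => cptb_user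
  end
with change_cptb := match goal with |- cpt (fun c => nat_of_bool (@?P c)) => change (cptb P) end
with cpt_user := fail
with cptb_user := fail.
Ltac cpt_auto := repeat (cbv beta; cpt_step).

(** * Pairing and codes of lists *)

Definition tri n := iteri n (fun i r => r + i.+1) 0.
(** Cantor's pairing. Both components are bounded by the pair, so the inverses are found by bounded
    search. *)
Definition pr a b := tri (a + b) + b.
Definition p1 z := bmin z.+1 (fun a => bex z.+1 (fun b => pr a b == z)).
Definition p2 z := bmin z.+1 (fun b => bex z.+1 (fun a => pr a b == z)).

Lemma cpt_tri k (f : ctx k -> nat) : cpt f -> cpt (fun c => tri (f c)).
Proof. by apply: cpt_app1; rewrite /tri; cpt_auto. Qed.

Ltac cpt_user ::= lazymatch goal with
  | |- cpt (fun c => tri _) => apply: cpt_tri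
  end.

Lemma triS n : tri n.+1 = tri n + n.+1. Proof. by []. Qed.

Lemma leq_tri n : n <= tri n.
Proof. by elim: n => // n; rewrite triS; lia. Qed.

Lemma tri_mono m n : m < n -> tri m + m < tri n.
Proof. by elim: n => // n IH; rewrite triS ltnS leq_eqVlt => /orP[/eqP->|/IH]; lia. Qed.

Lemma pr_inj a b a' b' : pr a b = pr a' b' -> a = a' /\ b = b'.
Proof.
rewrite /pr => E; case: (ltngtP (a + b) (a' + b')) => [lt|lt|E'].
- by have := tri_mono lt; lia.
- by have := tri_mono lt; lia.
- by move: E; rewrite E'; lia.
Qed.

Lemma pr_surj z : exists a b, z = pr a b.
Proof.
elim: z => [|z [a [b ->]]]; first by exists 0, 0.
case: a => [|a]; last by exists a, b.+1; rewrite /pr addSnnS; lia.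
by exists b.+1, 0; rewrite /pr add0n !addn0 triS; lia.
Qed.

Lemma leq_prl a b : a <= pr a b. Proof. by rewrite /pr; have := leq_tri (a + b); lia. Qed.
Lemma leq_prr a b : b <= pr a b. Proof. by rewrite /pr; lia. Qed.

Lemma p1K a b : p1 (pr a b) = a.
Proof.
have sat : bex (pr a b).+1 (fun b' => pr a b' == pr a b).
  by apply/bexP; exists b; rewrite // ltnS leq_prr.
have le := bmin_min (P := fun a' => bex (pr a b).+1 (fun b' => pr a' b' == pr a b))
  (leq_prl a b : a < (pr a b).+1) sat.
have /bmin_sat/bexP[b' _ /eqP/pr_inj[]//] : p1 (pr a b) < (pr a b).+1.
by rewrite ltnS (leq_trans le) // leq_prl.
Qed.

Lemma p2K a b : p2 (pr a b) = b.
Proof.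
have sat : bex (pr a b).+1 (fun a' => pr a' b == pr a b).
  by apply/bexP; exists a; rewrite // ltnS leq_prl.
have le := bmin_min (P := fun b' => bex (pr a b).+1 (fun a' => pr a' b' == pr a b))
  (leq_prr a b : b < (pr a b).+1) sat.
have /bmin_sat/bexP[b' _ /eqP/pr_inj[]//] : p2 (pr a b) < (pr a b).+1.
by rewrite ltnS (leq_trans le) // leq_prr.
Qed.

Lemma cpt_pr k (f g : ctx k -> nat) : cpt f -> cpt g -> cpt (fun c => pr (f c) (g c)).
Proof. by apply: cpt_app2; rewrite /pr; cpt_auto. Qed.

Ltac cpt_user ::= lazymatch goal with
  | |- cpt (fun c => tri _) => apply: cpt_tri
  | |- cpt (fun c => pr _ _) => apply: cpt_pr
  end.

Lemma cpt_p1 k (f : ctx k -> nat) : cpt f -> cpt (fun c => p1 (f c)).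
Proof. by apply: cpt_app1; rewrite /p1; cpt_auto. Qed.

Lemma cpt_p2 k (f : ctx k -> nat) : cpt f -> cpt (fun c => p2 (f c)).
Proof. by apply: cpt_app1; rewrite /p2; cpt_auto. Qed.

(** The successor keeps 0 free for the empty list and makes every number the code of a list. *)
Definition cns x l := (pr x l).+1.
Definition hd l := p1 l.-1.
Definition tl l := p2 l.-1.
Definition dr i l := iteri i (fun _ r => tl r) l.
Definition lc (s : seq nat) : nat := foldr cns 0 s.

Lemma cpt_cns k (f g : ctx k -> nat) : cpt f -> cpt g -> cpt (fun c => cns (f c) (g c)).
Proof. by apply: cpt_app2; rewrite /cns; cpt_auto. Qed.

Lemma cpt_hd k (f : ctx k -> nat) : cpt f -> cpt (fun c => hd (f c)).
Proof. by apply: cpt_app1; rewrite /hd; apply: cpt_p1; cpt_auto. Qed.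

Lemma cpt_tl k (f : ctx k -> nat) : cpt f -> cpt (fun c => tl (f c)).
Proof. by apply: cpt_app1; rewrite /tl; apply: cpt_p2; cpt_auto. Qed.

Ltac cpt_user ::= lazymatch goal with
  | |- cpt (fun c => tri _) => apply: cpt_tri
  | |- cpt (fun c => pr _ _) => apply: cpt_pr
  | |- cpt (fun c => p1 _) => apply: cpt_p1
  | |- cpt (fun c => p2 _) => apply: cpt_p2
  | |- cpt (fun c => cns _ _) => apply: cpt_cns
  | |- cpt (fun c => hd _) => apply: cpt_hd
  | |- cpt (fun c => tl _) => apply: cpt_tl
  end.

Lemma cpt_dr k (f g : ctx k -> nat) : cpt f -> cpt g -> cpt (fun c => dr (f c) (g c)).
Proof. by apply: cpt_app2; rewrite /dr; cpt_auto. Qed.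

Lemma hd_cns x l : hd (cns x l) = x. Proof. exact: p1K. Qed.
Lemma tl_cns x l : tl (cns x l) = l. Proof. exact: p2K. Qed.
Lemma tl0 : tl 0 = 0. Proof. exact: (p2K 0 0). Qed.

Lemma lc_surj n : exists s, n = lc s.
Proof.
elim/ltn_ind: n => -[|n] IH; first by exists [::].
have [a [b E]] := pr_surj n.
have [|s Es] := IH b; first by rewrite E ltnS leq_prr.
by exists (a :: s); rewrite /= -Es E.
Qed.

Lemma dr_lc i s : dr i (lc s) = lc (drop i s).
Proof.
elim: i => [|i IH]; first by rewrite drop0.
rewrite /dr iteriS -/(dr i (lc s)) IH -addn1 addnC -drop_drop.
by case: (drop i s) => [|x r]; rewrite ?tl0 //= tl_cns drop0.
Qed.

Lemma lc_eq0 s : (lc s == 0) = (s == [::]).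
Proof. by case: s. Qed.

Lemma hd_lc s : hd (lc s) = nth 0 s 0.
Proof. by case: s => [|x s]; [exact: (p1K 0 0) | exact: hd_cns]. Qed.

Lemma size_lc s : size s <= lc s.
Proof. by elim: s => //= x s IH; rewrite ltnS (leq_trans IH) ?leq_prr. Qed.

Lemma mem_leq_lc x s : x \in s -> x <= lc s.
Proof.
elim: s => //= y s IH; rewrite inE => /orP[/eqP->|/IH le].
  by rewrite ltnW // ltnS leq_prl.
by rewrite ltnW // ltnS (leq_trans le) ?leq_prr.
Qed.

(** * Course-of-values recursion *)

(** A history of length [n] is stored newest first, so the value at [i] lies at depth [n.-1 - i]. *)
Definition look r n i := hd (dr (n.-1 - i) r).
Definition histc (H : nat -> (nat -> nat) -> nat) n :=
  iteri n (fun i r => cns (H i (look r i)) r) 0.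
Definition cov H n := H n (look (histc H n) n).

Lemma dr_histc H j n : j <= n -> dr j (histc H n) = histc H (n - j).
Proof.
elim: j => [|j IH] jn; first by rewrite subn0.
rewrite /dr iteriS -/(dr _ _) IH 1?ltnW // -(subnSK jn).
by rewrite /histc iteriS tl_cns.
Qed.

Lemma look_histc H n i : i < n -> look (histc H n) n i = cov H i.
Proof.
move=> lt; rewrite /look dr_histc; last by lia.
have -> : n - (n.-1 - i) = i.+1 by lia.
by rewrite /histc iteriS hd_cns.
Qed.

Lemma cpt_cov k (H : ctx k -> nat -> (nat -> nat) -> nat) (B : ctx k -> nat) :
  cpt (fun d : ctx k.+2 => H d.1.1 d.2 (look d.1.2 d.2)) -> cpt B ->
  cpt (fun c => cov (H c) (B c)).
Proof.
move=> HH HB.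
have Hh : cpt (fun c => histc (H c) (B c)).
  apply: (cpt_iteri (g := fun c i r => cns (H c i (look r i)) r)) => //.
    by apply: cpt_cns => //; cpt_auto.
  exact: cpt_const.
exact: (cpt_subst (cpts_cons (cpts_cons (cpts_id k) Hh) HB) HH).
Qed.

Lemma cpt_look k (f g h : ctx k -> nat) :
  cpt f -> cpt g -> cpt h -> cpt (fun c => look (f c) (g c) (h c)).
Proof.
apply: cpt_app3; rewrite /look; apply: cpt_hd; apply: cpt_dr; cpt_auto.
Qed.

(** * A universal enumeration predicate *)

Fixpoint enc (e : rcode) : nat :=
  match e with
  | RZero => pr 0 0
  | RSucc => pr 1 0
  | RProj i => pr 2 i
  | RComp f gs => pr 3 (pr (enc f) (lc (map enc gs)))
  | RPrim f g => pr 4 (pr (enc f) (enc g))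
  | RMin f => pr 5 (enc f)
  end.

Definition ent c a y := pr c (pr a y).
Definition memc q S := bex S (fun i => (dr i S != 0) && (hd (dr i S) == q)).

Lemma memcE q s : memc q (lc s) = (q \in s).
Proof.
apply/bexP/idP => [[i _]|qs].
  rewrite dr_lc lc_eq0 hd_lc nth_drop addn0 => /andP[nz /eqP<-].
  rewrite mem_nth // ltnNge; apply: contra nz => le; by rewrite drop_oversize.
exists (index q s); first by rewrite (leq_trans _ (size_lc s)) ?index_mem.
rewrite dr_lc lc_eq0 hd_lc nth_drop addn0 nth_index // eqxx andbT.
by rewrite -size_eq0 size_drop subn_eq0 -ltnNge index_mem.
Qed.

(** Comparing the emptiness of the two remainders at every index, the length of the list included,
    forces equal lengths. *)
Definition revc gs a ys S :=
  ball gs.+1 (fun i => ((dr i gs == 0) == (dr i ys == 0)) &&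
    ((dr i gs == 0) || memc (ent (hd (dr i gs)) a (hd (dr i ys))) S)).

(* A certificate is a list of triples (code, arguments, value), each of which
   follows by one rule of [reval] from triples further down the list. *)
Definition just3 c a y S :=
  [|| (c == pr 0 0) && (y == 0),
      (c == pr 1 0) && ((a != 0) && (y == (hd a).+1)),
      (p1 c == 2) && ((dr (p2 c) a != 0) && (y == hd (dr (p2 c) a))),
      (p1 c == 3) && bex S.+1 (fun ys => memc (ent (p1 (p2 c)) ys y) S &&
                                        revc (p2 (p2 c)) a ys S),
      (p1 c == 4) && ((a != 0) && ((hd a == 0) && memc (ent (p1 (p2 c)) (tl a) y) S)),
      (p1 c == 4) && ((a != 0) && ((hd a != 0) && bex S.+1 (fun r =>
         memc (ent c (cns (hd a).-1 (tl a)) r) S &&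
         memc (ent (p2 (p2 c)) (cns (hd a).-1 (cns r (tl a))) y) S))) |
      (p1 c == 5) && (memc (ent (p2 c) (cns y a) 0) S &&
         ball y (fun m => bex S.+1 (fun k => memc (ent (p2 c) (cns m a) k.+1) S)))].

Definition just q S := just3 (p1 q) (p1 (p2 q)) (p2 (p2 q)) S.

Definition okc L := ball L.+1 (fun j => (dr j L == 0) || just (hd (dr j L)) (tl (dr j L))).

Definition cert c a y t := bex t (fun L => okc L && memc (ent c a y) L).

Arguments pr : simpl never.
Arguments p1 : simpl never.
Arguments p2 : simpl never.
Arguments hd : simpl never.
Arguments tl : simpl never.
Arguments cns : simpl never.
Arguments dr : simpl never.
Arguments lc : simpl never.

Section RcodeInd.
Variable P : rcode -> Prop.
Hypothesis P0 : P RZero.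
Hypothesis P1 : P RSucc.
Hypothesis P2 : forall i, P (RProj i).
Hypothesis P3 : forall f gs, P f -> (forall g, List.In g gs -> P g) -> P (RComp f gs).
Hypothesis P4 : forall f g, P f -> P g -> P (RPrim f g).
Hypothesis P5 : forall f, P f -> P (RMin f).

Fixpoint rcode_nested_ind (e : rcode) : P e :=
  match e with
  | RZero => P0 | RSucc => P1 | RProj i => P2 i
  | RComp f gs => P3 (rcode_nested_ind f)
     ((fix all gs : forall g, List.In g gs -> P g :=
       match gs with
       | [::] => fun g H => match H with end
       | h :: hs => fun g H => match H with
          | or_introl E => match E with erefl => rcode_nested_ind h end
          | or_intror H' => all hs g H' end
       end) gs)
  | RPrim f g => P4 (rcode_nested_ind f) (rcode_nested_ind g)
  | RMin f => P5 (rcode_nested_ind f)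
  end.
End RcodeInd.

Lemma reval_compE f gs v y :
  reval (RComp f gs) v y -> exists2 ys, revals gs v ys & reval f ys y.
Proof. by move=> H; inversion H; exists ys. Qed.

Lemma reval_prim0E f g v y : reval (RPrim f g) (0 :: v) y -> reval f v y.
Proof. by move=> H; inversion H. Qed.

Lemma reval_primSE f g n v y : reval (RPrim f g) (n.+1 :: v) y ->
  exists2 r, reval (RPrim f g) (n :: v) r & reval g (n :: r :: v) y.
Proof. by move=> H; inversion H; exists r. Qed.

Lemma reval_minE f v n : reval (RMin f) v n ->
  reval f (n :: v) 0 /\ forall m, m < n -> exists k, reval f (m :: v) k.+1.
Proof. by move=> H; inversion H. Qed.

Lemma revals_consE g gs v ys : revals (g :: gs) v ys ->
  exists y ys', [/\ ys = y :: ys', reval g v y & revals gs v ys'].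
Proof. by move=> H; inversion H; exists y, ys0. Qed.

(** Induction on the code. Uniqueness of values is what lets a computation ending in 0 refute an
    instance of a relation. *)
Lemma reval_fun e v y y' : reval e v y -> reval e v y' -> y = y'.
Proof.
elim/rcode_nested_ind: e v y y' => [|| i | f gs IHf IHgs | f g IHf IHg | f IHf] v y y' H H'.
- by inversion H; inversion H'.
- by inversion H; subst; inversion H'; subst.
- by inversion H; inversion H'.
- have [ys Hs Hf] := reval_compE H; have [ys' Hs' Hf'] := reval_compE H'.
  suff E : ys = ys' by subst; exact: IHf Hf Hf'.
  move: Hs Hs'; clear -IHgs; elim: gs ys ys' IHgs => [|g gs IH] ys ys' IHgs H1 H2.
    by inversion H1; inversion H2.
  have [y [zs [-> Hy Hz]]] := revals_consE H1.
  have [y' [zs' [-> Hy' Hz']]] := revals_consE H2; congr (_ :: _).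
    exact: IHgs (or_introl erefl) _ _ _ Hy Hy'.
  by apply: IH Hz Hz' => h Hh; apply: IHgs; right.
- case: v H H' => [|n v] H H'; first by inversion H.
  elim: n y y' H H' => [|n IH] y y' H H'.
    exact: IHf (reval_prim0E H) (reval_prim0E H').
  have [r Hr Hg] := reval_primSE H; have [r' Hr' Hg'] := reval_primSE H'.
  by have E := IH _ _ Hr Hr'; subst; exact: IHg Hg Hg'.
- have [H0 Hm] := reval_minE H; have [H0' Hm'] := reval_minE H'.
  case: (ltngtP y y') => // lt.
    by case: (Hm' _ lt) => k Hk; have := IHf _ _ _ H0 Hk.
  by case: (Hm _ lt) => k Hk; have := IHf _ _ _ H0' Hk.
Qed.

Lemma eq_pr a b a' b' : (pr a b == pr a' b') = (a == a') && (b == b').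
Proof. by apply/eqP/andP => [/pr_inj[-> ->]|[/eqP-> /eqP->]]. Qed.

Definition entry e v y := ent (enc e) (lc v) y.

(** This is why [just3] may bound its unknown lists, values and witnesses by the certificate
    itself. *)
Lemma entry_leq e v y s : entry e v y \in s -> (lc v <= lc s) /\ (y <= lc s).
Proof.
move/mem_leq_lc; rewrite /entry /ent => le.
have := leq_prr (enc e) (pr (lc v) y); have := leq_prl (lc v) y; have := leq_prr (lc v) y.
by move=> *; split; lia.
Qed.

Variant follows (s : seq nat) : rcode -> seq nat -> nat -> Prop :=
| fol_zero v : follows s RZero v 0
| fol_succ x v : follows s RSucc (x :: v) x.+1
| fol_proj i v : i < size v -> follows s (RProj i) v (nth 0 v i)
| fol_comp f gs v ys y : size ys = size gs ->
    (forall i, i < size gs -> entry (nth RZero gs i) v (nth 0 ys i) \in s) ->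
    entry f ys y \in s -> follows s (RComp f gs) v y
| fol_prim0 f g v y : entry f v y \in s -> follows s (RPrim f g) (0 :: v) y
| fol_primS f g n v r y : entry (RPrim f g) (n :: v) r \in s ->
    entry g (n :: r :: v) y \in s -> follows s (RPrim f g) (n.+1 :: v) y
| fol_min f v n : entry f (n :: v) 0 \in s ->
    (forall m, m < n -> exists k, entry f (m :: v) k.+1 \in s) ->
    follows s (RMin f) v n.

Lemma revcP gs v ys s :
  reflect (size ys = size gs /\
    forall i, i < size gs -> entry (nth RZero gs i) v (nth 0 ys i) \in s)
    (revc (lc (map enc gs)) (lc v) (lc ys) (lc s)).
Proof.
have drop0E (t : seq nat) i : (lc (drop i t) == 0) = (size t <= i).
  by rewrite lc_eq0 -size_eq0 size_drop subn_eq0.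
have nthE (t : seq nat) i : hd (lc (drop i t)) = nth 0 t i.
  by rewrite hd_lc nth_drop addn0.
apply: (iffP (ballP _ _)) => [H|[sz H] i _].
  have H' i : i <= size gs -> ((size gs <= i) == (size ys <= i)) &&
     ((size gs <= i) || (ent (nth 0 (map enc gs) i) (lc v) (nth 0 ys i) \in s)).
    move=> le; have /H : i < (lc (map enc gs)).+1.
      by rewrite ltnS (leq_trans le) // -(size_map enc) size_lc.
    by rewrite !dr_lc !drop0E !nthE memcE size_map.
  split.
    have /andP[/eqP] := H' _ (leqnn (size gs)); rewrite leqnn => /esym le1 _.
    apply/eqP; rewrite eqn_leq le1 /=; rewrite leqNgt; apply/negP => lt.
    have /andP[/eqP] := H' _ (ltnW lt); rewrite leqnn => E _.
    by move: lt; rewrite ltnNge E.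
  move=> i lt; have /andP[_] := H' _ (ltnW lt); rewrite leqNgt lt /=.
  by rewrite (nth_map RZero).
rewrite !dr_lc !drop0E !nthE memcE size_map sz eqxx /=.
by case: leqP => //= lt; rewrite (nth_map RZero) //; apply: H.
Qed.

Lemma just3P e v y s : reflect (follows s e v y) (just3 (enc e) (lc v) y (lc s)).
Proof.
have drop0E (t : seq nat) i : (lc (drop i t) != 0) = (i < size t).
  by rewrite lc_eq0 -size_eq0 size_drop subn_eq0 ltnNge.
have nthE (t : seq nat) i : hd (lc (drop i t)) = nth 0 t i.
  by rewrite hd_lc nth_drop addn0.
case: e => [|| i | f gs | f g | f]; rewrite /just3 /enc -/enc !eq_pr !(p1K, p2K) /= ?orbF.
- by apply: (iffP eqP) => [->|H]; [constructor | inversion H].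
- apply: (iffP andP) => [|H].
    case: v => [|x v] [] //= _ /eqP->; rewrite hd_lc; constructor.
  by inversion H; subst; rewrite hd_lc.
- rewrite dr_lc drop0E nthE; apply: (iffP andP) => [[lt /eqP->]|H]; first by constructor.
  by inversion H; subst; split.
- apply: (iffP (bexP _ _)) => [[ysn _]|H].
    have [ys ->] := lc_surj ysn; rewrite memcE => /andP[H1 /revcP[sz H2]].
    exact: (fol_comp sz H2 H1).
  inversion H; subst; exists (lc ys).
    by rewrite ltnS; case: (entry_leq H6).
  by rewrite memcE; apply/andP; split => //; apply/revcP.
- case: v => [|x v] /=.
    by constructor => H; inversion H.
  rewrite -[lc (x :: v)]/(cns x (lc v)) hd_cns tl_cns.
  case: x => [|n] /=.
    rewrite orbF memcE; apply: (iffP idP) => H; first by constructor.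
    by inversion H.
  apply: (iffP (bexP _ _)) => [[r _]|H].
    by rewrite !memcE => /andP[H1 H2]; apply: (fol_primS H1 H2).
  inversion H; subst; exists r; first by rewrite ltnS; case: (entry_leq H5).
  by rewrite !memcE; apply/andP.
- rewrite !memcE; apply: (iffP andP) => [[H1 /ballP H2]|H].
    constructor => // m /H2/bexP[k _]; rewrite memcE => Hk; by exists k.
  inversion_clear H as [| | | | | | ? ? ? A1 A2]; split => //; apply/ballP => m /A2[k Hk]; apply/bexP; exists k.
    by case: (entry_leq Hk) => _; rewrite ltnS; lia.
  by rewrite memcE.
Qed.

Fixpoint okl (s : seq nat) := if s is q :: r then just q (lc r) && okl r else true.

Lemma okcE s : okc (lc s) = okl s.
Proof.
have E : okl s <-> forall j, j < size s -> just (nth 0 s j) (lc (drop j.+1 s)).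
  elim: s => [|q s IH] //=; split.
    move=> /andP[H1 /IH H2] [|j] lt /=; first by rewrite drop0.
    exact: H2.
  move=> H; apply/andP; split; first by have := H 0 isT; rewrite /= drop0.
  by apply/IH => j lt; apply: (H j.+1).
have D0 j : (lc (drop j s) == 0) = (size s <= j).
  by rewrite lc_eq0 -size_eq0 size_drop subn_eq0.
have TL j : tl (lc (drop j s)) = lc (drop j.+1 s).
  rewrite -addn1 addnC -drop_drop.
  by case: (drop j s) => [|x r]; [exact: tl0 | rewrite /= drop0; exact: tl_cns].
apply/ballP/idP => [H|/E H j _].
  apply/E => j lt.
  have /H : j < (lc s).+1 by rewrite ltnS (leq_trans (ltnW lt)) ?size_lc.
  by rewrite dr_lc D0 leqNgt lt /= TL hd_lc nth_drop addn0.
rewrite dr_lc D0 TL hd_lc nth_drop addn0.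
by case: leqP => //= lt; apply: H.
Qed.

(** Induction on the certificate: every member rests only on members further down, which are sound
    by induction. *)
Lemma okl_sound s e v y : okl s -> entry e v y \in s -> reval e v y.
Proof.
elim: s e v y => [|q s IH] //= e v y /andP[J /[dup] ok /IH {}IH].
rewrite inE => /orP[/eqP E|]; last exact: IH.
move: J; rewrite -E /just /entry /ent !(p1K, p2K) => /just3P J {E}.
case: J; try by intros; constructor.
- move=> f gs {}v ys {}y sz H Hf; apply: ev_comp (IH _ _ _ Hf).
  elim: gs ys sz H {Hf} => [|g gs IHg] [|z ys] //= sz H; first by constructor.
  constructor; first exact/IH/(H 0).
  by apply: IHg => [|i lt]; [case: sz | apply: (H i.+1)].
- by move=> f g {}v {}y H; constructor; apply: IH.
- by move=> f g n {}v r {}y H1 H2; apply: ev_primS (IH _ _ _ H1) (IH _ _ _ H2).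
- move=> f {}v n H1 H2; constructor; first exact: IH.
  by move=> m /H2[k Hk]; exists k; apply: IH.
Qed.

(** Every member here is an [entry] of an actual code, so [follows] is at hand in the induction that
    concatenates certificates. *)
Inductive okp : seq nat -> Prop :=
| okp_nil : okp [::]
| okp_cons e v y s : follows s e v y -> okp s -> okp (entry e v y :: s).

Lemma okp_okl s : okp s -> okl s.
Proof.
elim=> //= e v y {}s J _ ->; rewrite andbT /just /entry /ent !(p1K, p2K).
exact/just3P.
Qed.

Lemma follows_sub s s' e v y : {subset s <= s'} -> follows s e v y -> follows s' e v y.
Proof.
move=> sub; case; try by intros; econstructor; eauto.
by move=> f {}v n H1 H2; constructor; [exact: sub | move=> m /H2[k /sub Hk]; exists k].
Qed.

Lemma okp_cat s s' : okp s -> okp s' -> okp (s ++ s').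
Proof.
move=> H H'; elim: H => //= e v y r J _ IH; constructor => //.
by apply: follows_sub J => q; rewrite mem_cat => ->.
Qed.

(** The certificates of the premises are concatenated and the conclusion is put in front; [RMin]
    takes one certificate for each smaller argument as well. *)
Lemma okp_complete e v y : reval e v y -> exists2 s, okp s & entry e v y \in s.
Proof.
have top E w z s : follows s E w z -> okp s ->
    exists2 s', okp s' & entry E w z \in s'.
  by move=> J ok; exists (entry E w z :: s); [constructor | rewrite mem_head].
elim/rcode_nested_ind: e v y => [|| i | f gs IHf IHgs | f g IHf IHg | f IHf] v y H.
- by inversion H; apply: (top _ _ _ [::]); constructor.
- by inversion H; apply: (top _ _ _ [::]); constructor.
- by inversion H; apply: (top _ _ _ [::]); constructor.
- have [ys Hs Hf] := reval_compE H; have [s1 ok1 in1] := IHf _ _ Hf.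
  suff [s2 ok2 [sz in2]] : exists2 s, okp s & size ys = size gs /\
      forall i, i < size gs -> entry (nth RZero gs i) v (nth 0 ys i) \in s.
    apply: (top _ _ _ (s1 ++ s2)); last exact: okp_cat.
    apply: fol_comp sz _ _; last by rewrite mem_cat in1.
    by move=> i lt; rewrite mem_cat in2 ?orbT.
  move: Hs IHgs; clear; elim: gs ys => [|g gs IH] ys H IHgs.
    by inversion H; subst; exists [::]; first by constructor.
  have [z [zs [-> Hz Hzs]]] := revals_consE H.
  have [s1 ok1 in1] := IHgs g (or_introl erefl) _ _ Hz.
  have [h Hh|s2 ok2 [sz in2]] := IH _ Hzs; first by apply: IHgs; right.
  exists (s1 ++ s2); first exact: okp_cat.
  split; first by rewrite /= sz.
  case=> [|i] lt /=; rewrite mem_cat ?in1 //.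
  by rewrite in2 ?orbT.
- case: v H => [|n v] H; first by inversion H.
  elim: n y H => [|n IH] y H.
    have [s1 ok1 in1] := IHf _ _ (reval_prim0E H).
    by apply: (top _ _ _ s1) => //; constructor.
  have [r Hr Hg] := reval_primSE H.
  have [s1 ok1 in1] := IH _ Hr; have [s2 ok2 in2] := IHg _ _ Hg.
  apply: (top _ _ _ (s1 ++ s2)); last exact: okp_cat.
  by apply: (@fol_primS _ _ _ _ _ r); rewrite mem_cat ?in1 ?in2 ?orbT.
- have [H0 Hm] := reval_minE H; have [s1 ok1 in1] := IHf _ _ H0.
  suff [s2 ok2 in2] : exists2 s, okp s &
      forall m, m < y -> exists k, entry f (m :: v) k.+1 \in s.
    apply: (top _ _ _ (s1 ++ s2)); last exact: okp_cat.
    constructor; first by rewrite mem_cat in1.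
    by move=> m /in2[k Hk]; exists k; rewrite mem_cat Hk orbT.
  move: Hm; clear -IHf; elim: y => [|y IH] H; first by exists [::]; first by constructor.
  have [m lt|s1 ok1 in1] := IH; first by apply: H; exact: ltnW.
  have [k Hk] := H y (leqnn _); have [s2 ok2 in2] := IHf _ _ Hk.
  exists (s1 ++ s2); first exact: okp_cat.
  move=> m; rewrite ltnS leq_eqVlt => /orP[/eqP->|/in1[k' Hk']].
    by exists k; rewrite mem_cat in2 orbT.
  by exists k'; rewrite mem_cat Hk'.
Qed.

(** Kleene's normal form: evaluation is the projection of a decidable relation. *)
Lemma certP e v y : (exists t, cert (enc e) (lc v) y t) <-> reval e v y.
Proof.
split=> [[t /bexP[L _]]|/okp_complete[s ok mem]].
  by have [s ->] := lc_surj L; rewrite okcE memcE => /andP[]; exact: okl_sound.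
by exists (lc s).+1; apply/bexP; exists (lc s) => //; rewrite okcE memcE okp_okl.
Qed.

Lemma cert_mono c a y t t' : t <= t' -> cert c a y t -> cert c a y t'.
Proof.
by move=> le /bexP[L lt H]; apply/bexP; exists L => //; apply: leq_trans lt le.
Qed.

(** * The coloring *)

(** The exponent of 2 in [n]. Searching below [n] suffices since [2 ^ i <= n] forces [i < n]; at 0
    the value is 0. *)
Definition lam n := bmin n (fun i => bex n.+1 (fun q => n == (q + q).+1 * 2 ^ i)).
Definition mu n := bmin n (fun i => n < 2 ^ i.+1).

(* [refuted t e x u v] becomes true for large [t] iff [R x u v w] fails for some [w],
   where [e] codes the relation [R]; hence [surv e x s b t] tends, as [t] and then [b]
   grow, to the first [s] instances of the Pi03 condition on [x]. *)
Definition refuted t e x u v :=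
  bex t (fun w => cert e (cns x (cns u (cns v (cns w 0)))) 0 t).
Definition surv e x s b t := ball s (fun u => bex b (fun v => ~~ refuted t e x u v)).
(* The value [m] means that there is no target. *)
Definition targetS (S : nat -> nat -> bool) m :=
  cov (fun e f => bmin m (fun x =>
    [&& 0 < x, S e x & ball e (fun e' => lam (f e') != lam x)])).
(** The level [m] both bounds the candidates and says how many instances they have to survive. *)
Definition target m b t e := targetS (fun e x => surv e x m b t) m e.
(* [y] is the only number of its row [2^m, 2^(m+1)) that survives to level [s]. *)
Definition sole m y s b t e :=
  surv e y s b t &&
  ball (2 ^ m.+1) (fun y' => [|| y' < 2 ^ m, y' == y | ~~ surv e y' s b t]).
(** The value [2 ^ m.+1] means that no element of the row qualifies. The index [e] is recovered from
    [l] through the [lam] of its target, and a suitable survival level [s] is searched below [b]. *)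
Definition rowpick l m b t :=
  bmin (2 ^ m.+1) (fun y => (2 ^ m <= y) && bex m (fun e =>
    [&& target m b t e < m, lam (target m b t e) == l & bex b (fun s => sole m y s b t e)])).
(** Removing the top power of 2 exposes the last gap of [x], from [mu (x - 2 ^ mu x)] to [mu x]; its
    weight is one more than the value of [f] at the picked element. That element is below
    [2 ^ mu x], so the recursion is well founded. *)
Definition Gstep l t x (f : nat -> nat) :=
  if x - 2 ^ mu x == 0 then 0 else
  f (x - 2 ^ mu x) +
  (if rowpick l (mu (x - 2 ^ mu x)) (mu x) t < 2 ^ (mu (x - 2 ^ mu x)).+1
   then (f (rowpick l (mu (x - 2 ^ mu x)) (mu x) t)).+1 else 0).
(** [l] and [t] stay fixed in the recursion: in [color] they belong to the whole number, also while
    a part of it is weighed. *)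
Definition G l t x := cov (Gstep l t) x.

Definition color n : bool * bool * bool :=
  (odd (lam n), odd (mu n), odd (G (lam n) (mu n) n)).

(** * Computability of the colouring *)

Lemma cpt_pow2 k (f : ctx k -> nat) : cpt f -> cpt (fun c => 2 ^ f c).
Proof.
apply: cpt_app1; apply: (@cpt_ext _ (fun c : ctx 1 => iteri c.2 (fun _ r => r + r) 1)).
  by move=> c; elim: (c.2) => //= n ->; rewrite expnS mul2n addnn.
by cpt_auto.
Qed.

Lemma cpt_odd k (f : ctx k -> nat) : cpt f -> cpt (fun c => nat_of_bool (odd (f c))).
Proof.
apply: (cpt_app1 (h := fun n => nat_of_bool (odd n))).
apply: (@cpt_ext _ (fun c : ctx 1 => iteri c.2 (fun _ r => 1 - r) 0)).
  by move=> c; elim: (c.2) => //= n ->; case: (odd n).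
by cpt_auto.
Qed.

Ltac cpt_user ::= lazymatch goal with
  | |- cpt (fun c => tri _) => apply: cpt_tri
  | |- cpt (fun c => pr _ _) => apply: cpt_pr
  | |- cpt (fun c => p1 _) => apply: cpt_p1
  | |- cpt (fun c => p2 _) => apply: cpt_p2
  | |- cpt (fun c => cns _ _) => apply: cpt_cns
  | |- cpt (fun c => hd _) => apply: cpt_hd
  | |- cpt (fun c => tl _) => apply: cpt_tl
  | |- cpt (fun c => dr _ _) => apply: cpt_dr
  | |- cpt (fun c => look _ _ _) => apply: cpt_look
  | |- cpt (fun c => expn 2 _) => apply: cpt_pow2
  end.

Lemma cpt_lam k (f : ctx k -> nat) : cpt f -> cpt (fun c => lam (f c)).
Proof. by apply: cpt_app1; rewrite /lam; cpt_auto. Qed.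

Lemma cpt_mu k (f : ctx k -> nat) : cpt f -> cpt (fun c => mu (f c)).
Proof. by apply: cpt_app1; rewrite /mu; cpt_auto. Qed.

Lemma cptb_memc k (f g : ctx k -> nat) : cpt f -> cpt g -> cptb (fun c => memc (f c) (g c)).
Proof.
by apply: (cpt_app2 (h := fun x y => nat_of_bool (memc x y))); rewrite /memc; cpt_auto.
Qed.

Ltac cptb_user ::= lazymatch goal with
  | |- cptb (fun c => memc _ _) => apply: cptb_memc
  end.

Lemma cptb_revc k (f1 f2 f3 f4 : ctx k -> nat) : cpt f1 -> cpt f2 -> cpt f3 -> cpt f4 ->
  cptb (fun c => revc (f1 c) (f2 c) (f3 c) (f4 c)).
Proof.
apply: (cpt_app4 (h := fun x y z t => nat_of_bool (revc x y z t))).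
by rewrite /revc /ent; cpt_auto.
Qed.

Ltac cptb_user ::= lazymatch goal with
  | |- cptb (fun c => memc _ _) => apply: cptb_memc
  | |- cptb (fun c => revc _ _ _ _) => apply: cptb_revc
  end.

Lemma cptb_just3 k (f1 f2 f3 f4 : ctx k -> nat) : cpt f1 -> cpt f2 -> cpt f3 -> cpt f4 ->
  cptb (fun c => just3 (f1 c) (f2 c) (f3 c) (f4 c)).
Proof.
apply: (cpt_app4 (h := fun x y z t => nat_of_bool (just3 x y z t))).
by rewrite /just3 /ent; cpt_auto.
Qed.

Lemma cptb_cert k (f1 f2 f3 f4 : ctx k -> nat) : cpt f1 -> cpt f2 -> cpt f3 -> cpt f4 ->
  cptb (fun c => cert (f1 c) (f2 c) (f3 c) (f4 c)).
Proof.
apply: (cpt_app4 (h := fun x y z t => nat_of_bool (cert x y z t))).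
rewrite /cert /okc /just /ent; cpt_auto.
by apply: cptb_just3; cpt_auto.
Qed.

Ltac cptb_user ::= lazymatch goal with
  | |- cptb (fun c => cert _ _ _ _) => apply: cptb_cert
  end.

Lemma cptb_surv k (f1 f2 f3 f4 f5 : ctx k -> nat) :
  cpt f1 -> cpt f2 -> cpt f3 -> cpt f4 -> cpt f5 ->
  cptb (fun c => surv (f1 c) (f2 c) (f3 c) (f4 c) (f5 c)).
Proof.
apply: (cpt_app5 (h := fun x y z t u => nat_of_bool (surv x y z t u))).
by rewrite /surv /refuted; cpt_auto.
Qed.

Ltac cpt_user ::= lazymatch goal with
  | |- cpt (fun c => look _ _ _) => apply: cpt_look
  | |- cpt (fun c => expn 2 _) => apply: cpt_pow2
  | |- cpt (fun c => lam _) => apply: cpt_lam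
  | |- cpt (fun c => mu _) => apply: cpt_mu
  end.
Ltac cptb_user ::= lazymatch goal with
  | |- cptb (fun c => surv _ _ _ _ _) => apply: cptb_surv
  end.

Lemma cpt_target k (f1 f2 f3 f4 : ctx k -> nat) : cpt f1 -> cpt f2 -> cpt f3 -> cpt f4 ->
  cpt (fun c => target (f1 c) (f2 c) (f3 c) (f4 c)).
Proof.
apply: cpt_app4; rewrite /target /targetS.
apply: (cpt_cov (H := fun c : ctx 4 => fun e f => bmin c.1.1.1.2 (fun x =>
  [&& 0 < x, surv e x c.1.1.1.2 c.1.1.2 c.1.2 & ball e (fun e' => lam (f e') != lam x)])));
by cpt_auto.
Qed.

Ltac cpt_user ::= lazymatch goal with
  | |- cpt (fun c => look _ _ _) => apply: cpt_look
  | |- cpt (fun c => expn 2 _) => apply: cpt_pow2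
  | |- cpt (fun c => lam _) => apply: cpt_lam
  | |- cpt (fun c => mu _) => apply: cpt_mu
  | |- cpt (fun c => target _ _ _ _) => apply: cpt_target
  end.

Lemma cpt_pick k (f1 f2 f3 f4 : ctx k -> nat) : cpt f1 -> cpt f2 -> cpt f3 -> cpt f4 ->
  cpt (fun c => rowpick (f1 c) (f2 c) (f3 c) (f4 c)).
Proof. by apply: cpt_app4; rewrite /rowpick /sole; cpt_auto. Qed.

Ltac cpt_user ::= lazymatch goal with
  | |- cpt (fun c => look _ _ _) => apply: cpt_look
  | |- cpt (fun c => expn 2 _) => apply: cpt_pow2
  | |- cpt (fun c => lam _) => apply: cpt_lam
  | |- cpt (fun c => mu _) => apply: cpt_mu
  | |- cpt (fun c => rowpick _ _ _ _) => apply: cpt_pick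
  end.

Lemma cpt_G k (f1 f2 f3 : ctx k -> nat) : cpt f1 -> cpt f2 -> cpt f3 ->
  cpt (fun c => G (f1 c) (f2 c) (f3 c)).
Proof.
apply: cpt_app3; rewrite /G.
by apply: (cpt_cov (H := fun c : ctx 3 => Gstep c.1.1.2 c.1.2)); rewrite /Gstep; cpt_auto.
Qed.

Lemma recursive_color : recursive_coloring color.
Proof.
have [e He] : cpt (fun c : ctx 1 => code3 (color c.2)).
  rewrite /color /code3.
  apply: cpt_add; last by apply: cpt_odd; apply: cpt_G; cpt_auto.
  by apply: cpt_add; apply: cpt_mul; try exact: cpt_const; apply: cpt_odd; cpt_auto.
by exists e => n; apply: (He (tt, n)).
Qed.

(** * Additivity of the gap weights *)

Lemma odd_part n : 0 < n -> exists i q, n = (q + q).+1 * 2 ^ i.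
Proof.
elim/ltn_ind: n => n IH n0; case On: (odd n).
  by exists 0, n./2; rewrite addnn muln1 -[LHS](odd_double_half n) On.
have En : n = n./2.*2 by rewrite -[LHS](odd_double_half n) On.
have [||i [q E]] := IH n./2; [by lia | by lia |].
by exists i.+1, q; rewrite En E expnS -muln2 -mulnA [2 ^ i * 2]mulnC.
Qed.

Lemma odd_part_uniq i q j r : (q + q).+1 * 2 ^ i = (r + r).+1 * 2 ^ j -> i = j.
Proof.
elim: i j => [|i IH] [|j] //.
- by rewrite expnS muln1; lia.
- by rewrite expnS muln1; lia.
- by rewrite !expnS => E; congr _.+1; apply: IH; lia.
Qed.

Lemma lamE i q : lam ((q + q).+1 * 2 ^ i) = i.
Proof.
set n := _ * _.
have p : 0 < 2 ^ i by rewrite expn_gt0.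
have ilt : i < n by rewrite /n (leq_trans (ltn_expl i (isT : 1 < 2))) //; nia.
have sat : bex n.+1 (fun q' => n == (q' + q').+1 * 2 ^ i).
  by apply/bexP; exists q; rewrite // /n; nia.
have le : lam n <= i by exact: bmin_min ilt sat.
have /bmin_sat/bexP[r _ /eqP] : lam n < n by exact: leq_ltn_trans le ilt.
by move/odd_part_uniq.
Qed.

Lemma lamP n : 0 < n -> exists q, n = (q + q).+1 * 2 ^ lam n.
Proof. by move/odd_part=> [i [q ->]]; exists q; rewrite lamE. Qed.

Lemma muP n : 0 < n -> 2 ^ mu n <= n < 2 ^ (mu n).+1.
Proof.
move=> n0.
have lt1 : n.-1 < n by lia.
have sat : n < 2 ^ (n.-1).+1 by rewrite prednK // ltn_expl.
have le : mu n <= n.-1 by exact: bmin_min lt1 sat.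
have ltn : mu n < n by lia.
rewrite (bmin_sat (P := fun i => n < 2 ^ i.+1) ltn) andbT.
case E : (mu n) => [|k] //; rewrite leqNgt; apply/negP => H.
have := bmin_min (n := n) (P := fun i => n < 2 ^ i.+1) (i := k).
by rewrite -/(mu n) E ltnn; move/(_ _ H)=> F; have := F (ltac:(lia)).
Qed.

Lemma muE n k : 2 ^ k <= n < 2 ^ k.+1 -> mu n = k.
Proof.
move=> /andP[H1 H2]; have n0 : 0 < n by rewrite (leq_trans _ H1) ?expn_gt0.
have /andP[H3 H4] := muP n0; apply/eqP; rewrite eqn_leq; apply/andP; split;
  rewrite -ltnS -(ltn_exp2l _ _ (isT : 1 < 2)).
  exact: leq_ltn_trans H3 H2.
exact: leq_ltn_trans H1 H4.
Qed.

Lemma pow_lam_leq n : 0 < n -> 2 ^ lam n <= n.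
Proof. by move=> /lamP[q ->]; rewrite lamE; nia. Qed.

Lemma lam_leq_mu n : 0 < n -> lam n <= mu n.
Proof.
move=> n0; rewrite -ltnS -(ltn_exp2l _ _ (isT : 1 < 2)).
by apply: leq_ltn_trans (pow_lam_leq n0) _; case/andP: (muP n0).
Qed.

Lemma lam_pow k : lam (2 ^ k) = k.
Proof. by rewrite -[2 ^ k]mul1n -[1]/((0 + 0).+1) lamE. Qed.

Lemma mu_pow k : mu (2 ^ k) = k.
Proof. by apply: muE; rewrite leqnn ltn_exp2l /=. Qed.

Lemma lam_add x z : 0 < x -> 0 < z -> x < 2 ^ lam z -> lam (x + z) = lam x.
Proof.
move=> x0 z0 lt; have lt' : lam x < lam z.
  by rewrite -(ltn_exp2l _ _ (isT : 1 < 2)) (leq_ltn_trans (pow_lam_leq x0) lt).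
have [q Eq] := lamP x0; have [r Er] := lamP z0; rewrite {1}Eq {1}Er.
have -> : lam z = lam x + (lam z - lam x).-1.+1 by lia.
rewrite expnD expnS; set d := 2 ^ _.-1; set p := 2 ^ lam x.
have -> : (q + q).+1 * p + (r + r).+1 * (p * (2 * d)) =
  ((q + (r + r).+1 * d) + (q + (r + r).+1 * d)).+1 * p by lia.
exact: lamE.
Qed.

(** Both [z] and [2 ^ (mu z).+1] are multiples of [2 ^ lam z], so there is room for [x] between
    them. *)
Lemma mu_add x z : 0 < z -> x < 2 ^ lam z -> mu (x + z) = mu z.
Proof.
move=> z0 lt; have /andP[H1 H2] := muP z0; apply: muE.
have [q Eq] := lamP z0; have le := lam_leq_mu z0.
have [d Ed] : exists d, 2 ^ (mu z).+1 = d * 2 ^ lam z.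
  by exists (2 ^ ((mu z).+1 - lam z)); rewrite -expnD subnK // ltnW.
rewrite Ed in H2 *; set p := 2 ^ lam z in Eq lt H2 *.
have : (q + q).+1 < d by move: H2; rewrite {1}Eq; nia.
by move=> ?; apply/andP; split; nia.
Qed.

Lemma split_top z : 0 < z ->
  [/\ z = (z - 2 ^ mu z) + 2 ^ mu z & z - 2 ^ mu z < 2 ^ mu z].
Proof. by move=> /muP/andP[]; rewrite expnS => *; split; lia. Qed.

Definition gap_weight l m b t :=
  if rowpick l m b t < 2 ^ m.+1 then (G l t (rowpick l m b t)).+1 else 0.

Lemma G_pow l t k : G l t (2 ^ k) = 0.
Proof. by rewrite /G /cov /Gstep mu_pow subnn eqxx. Qed.

Lemma G_top l t x k : 0 < x -> x < 2 ^ k ->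
  G l t (x + 2 ^ k) = G l t x + gap_weight l (mu x) k t.
Proof.
move=> x0 lt; have p : 0 < 2 ^ k by rewrite expn_gt0.
rewrite {1}/G /cov; set f := look _ _.
have fE i : i < x + 2 ^ k -> f i = G l t i by exact: look_histc.
rewrite /Gstep mu_add ?lam_pow // mu_pow addnK (negPf (lt0n_neq0 x0)) fE; last by lia.
rewrite /gap_weight; case: ifP => // ltp; rewrite fE //.
(* It remains to see that the picked element lies below the argument, where the history is valid. *)
have /andP[H _] := muP x0.
have : 2 ^ (mu x).+1 <= 2 ^ k.
  by rewrite leq_exp2l // -(ltn_exp2l _ _ (isT : 1 < 2)) (leq_ltn_trans H lt).
by lia.
Qed.

(** Induction on [z] by removing its highest power: the remainder has the same highest exponent with
    and without [x], so the top gap weighs the same on both sides. When [z] is a power of 2, the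
    only new gap is [(mu x, lam z)]. *)
Lemma G_add l t x z : 0 < x -> 0 < z -> x < 2 ^ lam z ->
  G l t (x + z) = G l t x + gap_weight l (mu x) (lam z) t + G l t z.
Proof.
elim/ltn_ind: z => z IH x0 z0 lt; have [Ez ltz] := split_top z0.
set z' := z - _ in Ez ltz; set k := mu z in Ez ltz.
have p : 0 < 2 ^ k by rewrite expn_gt0.
case: (posnP z') => [E|z'0].
  have Ek : z = 2 ^ k by rewrite Ez E.
  by move: lt; rewrite Ek lam_pow => lt; rewrite G_top // G_pow addn0.
have El : lam z = lam z' by rewrite Ez lam_add // lam_pow.
have lt' : x < 2 ^ lam z' by rewrite -El.
have Em : mu (x + z') = mu z' by exact: mu_add.
have ltk : x + z' < 2 ^ k.
  have /andP[_ H] : 2 ^ mu (x + z') <= x + z' < 2 ^ (mu (x + z')).+1 by apply: muP; lia.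
  apply: leq_trans H _; rewrite Em leq_exp2l // -(ltn_exp2l _ _ (isT : 1 < 2)).
  by apply: leq_ltn_trans ltz; case/andP: (muP z'0).
rewrite {1 3}Ez addnA G_top //; last by lia.
rewrite IH //; last by lia.
by rewrite Em G_top // El; lia.
Qed.

(** * Nested limits *)

(** An iterated limit: the threshold for [t] depends on [b]. In the application [b] is the lowest
    exponent of a later element, and [t] the highest exponent of an element chosen after that. *)
Definition ev2 (Q : nat -> nat -> Prop) :=
  exists B, forall b, B <= b -> exists T, forall t, T <= t -> Q b t.

Lemma ev2_mono (Q Q' : nat -> nat -> Prop) :
  (forall b t, Q b t -> Q' b t) -> ev2 Q -> ev2 Q'.
Proof.
move=> sub [B HB]; exists B => b /HB[T HT]; exists T => t /HT; exact: sub.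
Qed.

Lemma ev2_and Q Q' : ev2 Q -> ev2 Q' -> ev2 (fun b t => Q b t /\ Q' b t).
Proof.
move=> [B HB] [B' HB']; exists (maxn B B') => b; rewrite geq_max => /andP[/HB[T HT] /HB'[T' HT']].
by exists (maxn T T') => t; rewrite geq_max => /andP[/HT ? /HT' ?].
Qed.

Lemma ev2_all n (Q : nat -> nat -> nat -> Prop) : (forall i, i < n -> ev2 (Q i)) ->
  ev2 (fun b t => forall i, i < n -> Q i b t).
Proof.
elim: n => [|n IH] H; first by exists 0 => b _; exists 0.
have := ev2_and (IH (fun i lt => H i (ltnW lt))) (H n (leqnn _)).
apply: ev2_mono => b t [H1 H2] i; rewrite ltnS leq_eqVlt => /orP[/eqP->//|]; exact: H1.
Qed.

Lemma ev2_point Q : ev2 Q -> exists b t, Q b t.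
Proof. by move=> [B /(_ B (leqnn _))[T /(_ T (leqnn _))]]; exists B, T. Qed.

Lemma ev2_geq n : ev2 (fun b t => n <= b).
Proof. by exists n => b le; exists 0. Qed.

Lemma refuted_mono t t' e x u v : t <= t' -> refuted t e x u v -> refuted t' e x u v.
Proof.
move=> le /bexP[w lt H]; apply/bexP; exists w; first exact: leq_trans lt le.
exact: cert_mono le H.
Qed.

Definition survives e x s := forall u, u < s -> exists v, forall t, ~~ refuted t e x u v.

(** A witness [v] is found once [b] exceeds it. Without a witness, each of the finitely many [v < b]
    is refuted at some time and stays refuted. *)
Lemma ev2_surv e x s : ev2 (fun b t => surv e x s b t <-> survives e x s).
Proof.
have : ev2 (fun b t => forall u, u < s ->
    bex b (fun v => ~~ refuted t e x u v) <-> exists v, forall t, ~~ refuted t e x u v).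
  apply: ev2_all => u _.
  case: (classic (exists v, forall t, ~~ refuted t e x u v)) => [[v Hv]|N].
    exists v.+1 => b le; exists 0 => t _; split=> _; first by exists v.
    by apply/bexP; exists v.
  exists 0 => b _.
  have [T HT] : exists T, forall t, T <= t -> forall v, v < b -> refuted t e x u v.
    elim: b => [|b [T HT]]; first by exists 0.
    have [T' HT'] : exists t, refuted t e x u b.
      apply: NNPP => N'; apply: N; exists b => t; apply/negP => R; apply: N'; by exists t.
    exists (maxn T T') => t; rewrite geq_max => /andP[le le'] v.
    rewrite ltnS leq_eqVlt => /orP[/eqP->|]; [exact: refuted_mono HT' | exact: HT].
  exists T => t le; split=> // /bexP[v lt]; by rewrite HT.
apply: ev2_mono => b t H; split=> [/ballP S u lt|S].
  by apply/(H u lt); apply: S.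
by apply/ballP => u lt; apply/(H u lt); apply: S.
Qed.

Lemma surv_leq e x s s' b t : s <= s' -> surv e x s' b t -> surv e x s b t.
Proof. by move=> le /ballP H; apply/ballP => u lt; apply: H; apply: leq_trans lt le. Qed.

Lemma survives_leq e x s s' : s <= s' -> survives e x s' -> survives e x s.
Proof. by move=> le H u lt; apply: H; apply: leq_trans lt le. Qed.

Lemma Pi03_survives A : Pi03 A -> exists e, forall x, A x <-> forall s, survives e x s.
Proof.
move=> [R [[E HE] HA]]; exists (enc E) => x.
have H u v : (forall t, ~~ refuted t (enc E) x u v) <-> forall w, R x u v w.
  split=> [N w|N t].
    apply/negPn/negP => /negPf F.
    have := HE x u v w; rewrite F => /certP[t Ht].
    have /negP := N (maxn t w.+1); apply; apply/bexP; exists w; first exact: leq_maxr.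
    exact: cert_mono (leq_maxl _ _) Ht.
  apply/negP => /bexP[w _ C].
  have /reval_fun/(_ (HE x u v w)) : reval E [:: x; u; v; w] 0 by apply/certP; exists t.
  by rewrite N.
rewrite HA; split=> [F s u _|F u].
  by have [v /H] := F u; exists v.
have [v /H] := F u.+1 u (leqnn _); by exists v.
Qed.

Lemma targetSE S m e : targetS S m e = bmin m (fun x =>
  [&& 0 < x, S e x & ball e (fun e' => lam (targetS S m e') != lam x)]).
Proof.
rewrite /targetS {1}/cov; apply: eq_bmin => x _; do 2!congr (_ && _).
apply: eq_in_all => e'; rewrite mem_iota => /andP[_ lt]; by rewrite look_histc.
Qed.

(** The target depends on finitely many survival tests only, hence is constant once these have
    reached their limits. *)
Lemma eq_targetS S S' m e :
  (forall e', e' <= e -> forall x, x < m -> S e' x = S' e' x) ->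
  targetS S m e = targetS S' m e.
Proof.
elim/ltn_ind: e => e IH H; rewrite [LHS]targetSE [RHS]targetSE; apply: eq_bmin => x ltx.
rewrite (H e (leqnn e) x ltx); apply: (congr1 (andb _)); apply: (congr1 (andb _)).
apply: eq_in_all => e'; rewrite mem_iota => /andP[_ lt].
rewrite (IH e' lt) // => e'' le; apply: H; exact: leq_trans le (ltnW lt).
Qed.

(** * Solutions *)

Lemma mu_geq K n : 2 ^ K <= n -> K <= mu n.
Proof.
move=> le; have n0 : 0 < n by rewrite (leq_trans _ le) ?expn_gt0.
rewrite -ltnS -(ltn_exp2l _ _ (isT : 1 < 2)) (leq_ltn_trans le) //.
by case/andP: (muP n0).
Qed.

Lemma lt_pow_mu n k : 0 < n -> mu n < k -> n < 2 ^ k.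
Proof.
move=> n0 lt; have /andP[_ H] := muP n0; apply: leq_trans H _; by rewrite leq_exp2l.
Qed.

Lemma FS_sum (A : nat -> Prop) F : F != [::] -> uniq F -> (forall x, x \in F -> A x) ->
  FS A (\sum_(x <- F) x).
Proof. by exists F. Qed.

Lemma target_sat m b t e : target m b t e < m ->
  [&& 0 < target m b t e, surv e (target m b t e) m b t &
      ball e (fun e' => lam (target m b t e') != lam (target m b t e))].
Proof. by rewrite {1}/target targetSE => /bmin_sat; rewrite -targetSE. Qed.

Lemma color_G m n : color m = color n ->
  odd (G (lam m) (mu m) m) = odd (G (lam n) (mu n) n).
Proof. by case. Qed.

Section Solution.
Variable A : nat -> Prop.
Hypothesis Ainf : infinite_set A.
Hypothesis Amono : monochromatic color (FS A).

Lemma color_FS s s' : FS A s -> FS A s' -> color s = color s'.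
Proof. by case: Amono => col H /H-> /H->. Qed.

Lemma color_elt_sum x y : A x -> A y -> x < y -> color (x + y) = color x.
Proof.
move=> Ax Ay lt; apply: color_FS.
  have -> : x + y = \sum_(i <- [:: x; y]) i by rewrite big_cons big_seq1.
  apply: FS_sum; rewrite //= ?inE ?andbT ?neq_ltn ?lt // => z.
  by rewrite !inE => /orP[]/eqP->.
have := @FS_sum A [:: x] isT isT; rewrite big_seq1; apply => z.
by rewrite inE => /eqP->.
Qed.

(** The sum of two numbers with highest exponent [k] has highest exponent [k.+1], which flips the
    second bit of the colour. *)
Lemma mu_distinct x y : A x -> A y -> 0 < x -> x < y -> mu x != mu y.
Proof.
move=> Ax Ay x0 lt; apply/eqP => E.
have := color_elt_sum Ax Ay lt; rewrite /color => -[_ + _].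
have -> : mu (x + y) = (mu x).+1; last by rewrite /=; case: odd.
have /andP[H1 H2] := muP x0; have /andP[] := muP (leq_trans x0 (ltnW lt)).
rewrite -E => H3 H4; apply: muE; move: H2 H4; rewrite !expnS; lia.
Qed.

(** If [q + r] were even, [x + y] would have lowest exponent exactly [k.+1], which flips the first
    bit. *)
Lemma lam_half_parity x y q r k : A x -> A y -> x < y ->
  x = (q + q).+1 * 2 ^ k -> y = (r + r).+1 * 2 ^ k -> odd q != odd r.
Proof.
move=> Ax Ay lt Ex Ey; apply/eqP => E.
have := color_elt_sum Ax Ay lt; rewrite /color => -[+ _ _].
have [h Eh] : exists h, q + r = h + h.
  by exists (q + r)./2; rewrite addnn -[LHS]odd_double_half oddD E addbb.
have -> : x + y = (h + h).+1 * 2 ^ k.+1 by rewrite Ex Ey -Eh expnS; lia.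
by rewrite Ex !lamE /=; case: odd.
Qed.

Lemma lam_thrice x y z : A x -> A y -> A z -> 0 < x -> x < y -> y < z ->
  lam x = lam y -> lam y = lam z -> False.
Proof.
move=> Ax Ay Az x0 xy yz E1 E2.
have [q Eq] := lamP x0; have [r Er] := lamP (leq_trans x0 (ltnW xy)).
have [s Es] := lamP (leq_trans x0 (ltnW (ltn_trans xy yz))).
rewrite -E2 -E1 in Es; rewrite -E1 in Er.
have := lam_half_parity Ax Ay xy Eq Er; have := lam_half_parity Ay Az yz Er Es.
have := lam_half_parity Ax Az (ltn_trans xy yz) Eq Es.
by case: (odd q); case: (odd r); case: (odd s).
Qed.

(** Each value of [lam] is taken by at most two positive elements of [A], so all small values are
    exhausted. *)
Lemma lam_unbounded K : exists M, forall y, A y -> M <= y -> K <= lam y.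
Proof.
elim: K => [|K [M HM]]; first by exists 0.
apply: NNPP => N.
have get n : exists2 y, A y & n <= y /\ lam y = K.
  apply: NNPP => N'; apply: N; exists (maxn M n) => y Ay; rewrite geq_max => /andP[le1 le2].
  have := HM _ Ay le1; rewrite leq_eqVlt => /orP[/eqP E|//].
  by case: N'; exists y.
have [x Ax [x1 Ex]] := get 1; have [y Ay [xy Ey]] := get x.+1.
have [z Az [yz Ez]] := get y.+1.
by apply: (lam_thrice Ax Ay Az x1 xy yz); congruence.
Qed.

(** A supply of elements that earlier sets cannot reserve completely: each of them reserves a single
    value of [lam]. *)
Lemma distinct_lams n : exists xs K, [/\ size xs = n,
  forall x, x \in xs -> [/\ A x, 0 < x & lam x < K] & uniq (map lam xs)].
Proof.
elim: n => [|n [xs [K [sz H U]]]]; first by exists [::], 0.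
have [M HM] := lam_unbounded K; have [x [le Ax]] := Ainf M.+1.
have le' := HM _ Ax (ltnW le).
exists (x :: xs), (lam x).+1; split; first by rewrite /= sz.
  move=> y; rewrite inE => /orP[/eqP->|/H[Ay y0 lt]]; split => //; first by lia.
  by lia.
rewrite /= U andbT; apply/mapP => -[y /H[_ _ lt] E].
by rewrite E leqNgt lt in le'.
Qed.

(** * Convergence of the targets and of the picks *)

Variable e : nat.
Hypothesis Ae : forall x, A x <-> forall s, survives e x s.

Lemma death_level N : exists s, forall x, x < N -> ~ A x -> ~ survives e x s.
Proof.
elim: N => [|N [s Hs]]; first by exists 0.
case: (classic (A N)) => [AN|nAN].
  exists s => x; rewrite ltnS leq_eqVlt => /orP[/eqP-> //|]; exact: Hs.
have [s' Hs'] : exists s', ~ survives e N s'.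
  by apply: NNPP => H; apply: nAN; apply/Ae => s'; apply: NNPP => H'; apply: H; exists s'.
exists (maxn s s') => x; rewrite ltnS leq_eqVlt => /orP[/eqP-> _|lt nAx] S.
  exact/Hs'/(survives_leq (leq_maxr s s') S).
exact/(Hs x lt nAx)/(survives_leq (leq_maxl s s') S).
Qed.

(** Of [e.+1] elements with distinct [lam], one is left free by the [e] earlier targets, so the
    limit target is at most that element. It stays below a bound independent of [m], and below that
    bound survival to a high level means membership. *)
Lemma target_converges : exists M, forall m, M <= m -> exists X,
  [/\ A X, 0 < X & X < M] /\ ev2 (fun b t => target m b t e = X).
Proof.
have [xs [K [sz Hxs Uxs]]] := distinct_lams e.+1.
pose N := (\max_(x <- xs) x).+1; have [s0 Hs0] := death_level N.
exists (maxn N s0) => m; rewrite geq_max => /andP[Nm s0m].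
have ev : ev2 (fun b t => forall e', e' < e.+1 -> forall x, x < m ->
    surv e' x m b t <-> survives e' x m).
  by apply: ev2_all => e' _; apply: ev2_all => x _; exact: ev2_surv.
(* At this single point all relevant tests have their limit values, so the limit target can be read
   off there. *)
have [b0 [t0 H0]] := ev2_point ev.
exists (target m b0 t0 e); split; last first.
  apply: ev2_mono ev => b t H; apply: eq_targetS => e' le x lt.
  have [h1 h2] := H e' le x lt; have [k1 k2] := H0 e' le x lt.
  by apply/idP/idP => S; [exact: k2 (h1 S) | exact: h2 (k1 S)].
have [x xin Hx] : exists2 x, x \in xs &
    lam x \notin [seq lam (target m b0 t0 e') | e' <- iota 0 e].
  apply: NNPP => C.
  have sub : {subset map lam xs <= [seq lam (target m b0 t0 e') | e' <- iota 0 e]}.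
    move=> l /mapP[x xin ->]; apply/negPn/negP => Hx; apply: C; by exists x.
  by have := uniq_leq_size Uxs sub; rewrite !size_map sz size_iota ltnn.
have [Ax x0 _] := Hxs x xin.
have xN : x < N by rewrite ltnS; exact: leq_bigmax_seq.
have le : target m b0 t0 e <= x.
  rewrite /target targetSE; apply: bmin_min; first exact: leq_trans xN Nm.
  rewrite x0 /=; apply/andP; split.
    exact: (proj2 (H0 e (ltnSn e) x (leq_trans xN Nm))) (proj1 (Ae x) Ax m).
  apply/ballP => e' lt; apply: contraNneq Hx => <-.
  by apply/mapP; exists e' => //; rewrite mem_iota.
have ltN : target m b0 t0 e < N by exact: leq_ltn_trans le xN.
have ltm : target m b0 t0 e < m by exact: leq_trans ltN Nm.
have /and3P[X0 SX _] := target_sat ltm.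
split=> //; last by exact: leq_trans ltN (leq_maxl _ _).
apply: NNPP => nA; apply: (Hs0 _ ltN nA); apply: survives_leq s0m _.
exact: (proj1 (H0 e (ltnSn e) _ ltm)) SX.
Qed.

Lemma target_lam_inj m b t i j : i < m -> j < m ->
  target m b t i < m -> target m b t j < m ->
  lam (target m b t i) = lam (target m b t j) -> i = j.
Proof.
have key i' j' : i' < j' -> target m b t j' < m ->
    lam (target m b t i') <> lam (target m b t j').
  move=> lt /target_sat.
  by case/and3P=> _ _ /ballP/(_ i' lt)/eqP.
move=> _ _ Hi Hj E; case: (ltngtP i j) => // lt; first by case: (key _ _ lt Hj).
by case: (key _ _ lt Hi).
Qed.

(** [w] is the only member of [A] in its row, and the rest of the row dies by a common level [s0];
    once [b] exceeds [s0], [w] qualifies. As [lam X] singles out the index [e], nothing else does.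
    The bound on [X] is uniform in [w], ready for a pigeonhole argument. *)
Lemma pick_converges : exists M, forall w, A w -> 0 < w -> M <= mu w -> exists X,
  [/\ A X, 0 < X & X < M] /\ ev2 (fun b t => rowpick (lam X) (mu w) b t = w).
Proof.
have [M HM] := target_converges; exists (maxn M e.+1) => w Aw w0.
rewrite geq_max => /andP[Mm em]; set m := mu w in Mm em *.
have /andP[w1 w2] := muP w0; rewrite -/m in w1 w2.
have [X [[AX X0 XM] evX]] := HM m Mm.
exists X; split; first by split => //; apply: leq_trans XM (leq_maxl _ _).
have uniqA y : 2 ^ m <= y < 2 ^ m.+1 -> A y -> y = w.
  move=> H Ay; have Em := muE H; have y0 : 0 < y.
    by case/andP: H => H _; apply: leq_trans H; rewrite expn_gt0.
  case: (ltngtP y w) => // lt.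
    by have := mu_distinct Ay Aw y0 lt; rewrite Em eqxx.
  by have := mu_distinct Aw Ay w0 lt; rewrite Em eqxx.
have [s0 Hs0] := death_level (2 ^ m.+1).
have evS : ev2 (fun b t => forall s, s < s0.+1 -> forall y, y < 2 ^ m.+1 ->
    surv e y s b t <-> survives e y s).
  by apply: ev2_all => s _; apply: ev2_all => y _; exact: ev2_surv.
apply: ev2_mono (ev2_and (ev2_geq s0.+1) (ev2_and evX evS)) => b t [s0b [ET HS]].
have wS s : s <= s0 -> surv e w s b t by move=> le; exact: (proj2 (HS s le w w2)) (proj1 (Ae w) Aw s).
have dead y : 2 ^ m <= y < 2 ^ m.+1 -> surv e y s0 b t -> y = w.
  move=> H S; apply: uniqA => //; apply: NNPP => nA.
  have lt : y < 2 ^ m.+1 by case/andP: H.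
  exact: (Hs0 y lt nA) (proj1 (HS s0 (ltnSn _) y lt) S).
have Xm : X < m by exact: leq_trans XM Mm.
have sat : (2 ^ m <= w) && bex m (fun e' => [&& target m b t e' < m,
    lam (target m b t e') == lam X & bex b (fun s => sole m w s b t e')]).
  rewrite w1; apply/bexP; exists e => //; rewrite ET Xm eqxx /=.
  apply/bexP; exists s0 => //; rewrite /sole wS //=; apply/ballP => y lt.
  case: leqP => //= le; case: eqVneq => //= ne; apply/negP => S.
  by move/eqP: ne; apply; apply: dead => //; rewrite le.
have le : rowpick (lam X) m b t <= w by exact: bmin_min w2 sat.
have ltp : rowpick (lam X) m b t < 2 ^ m.+1 by exact: leq_ltn_trans le w2.
have /andP[p1' /bexP[e' lt' /and3P[T1 /eqP T2 /bexP[s ltsb /andP[S1 /ballP S2]]]]] :=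
  bmin_sat ltp.
have Ee : e' = e by apply: (target_lam_inj lt' em T1); rewrite ET // T2.
rewrite -/(rowpick (lam X) m b t) in p1' S1 S2; subst e'.
(* Up to level [s0] the member [w] survives as well, so a sole survivor must be [w]; a survivor to a
   later level has survived to [s0], hence is [w] too. *)
case: (leqP s s0) => les.
  have := S2 w w2; rewrite ltnNge w1 /= wS //= orbF => /eqP->.
  by [].
by apply: dead; [rewrite p1' | exact: surv_leq (ltnW les) S1].
Qed.

(** * Two sums of different colours *)

(** [X + w + x + y + z] and [X + w + y + z] have the same colour, yet their total weights differ by
    an odd number. The pair [y + z] acts as one last block: [lam y] ends a gap, while [mu z], chosen
    later, is as large as the inner limits require. *)
Lemma no_solution : False.
Proof.
have [M HM] := pick_converges.
have elt n : exists2 w, A w & [/\ n <= w, n <= lam w & n <= mu w].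
  have [N HN] := lam_unbounded n.
  have [w [le Aw]] := Ainf (maxn (maxn N n) (2 ^ n)).
  move: le; rewrite !geq_max => /andP[/andP[le1 le2] le3]; exists w => //.
  by split => //; [exact: HN | exact: mu_geq].
(* Pigeonhole: every far [w] has its [X] below the fixed [M], so some [X] serves arbitrarily large
   [w]. *)
have [X [AX X0 XM HX]] : exists X, [/\ A X, 0 < X, X < M & forall n, exists2 w,
    A w & n <= w /\ ev2 (fun b t => rowpick (lam X) (mu w) b t = w)].
  apply: NNPP => C.
  have /(_ M (leqnn M))[n Hn] : forall k, k <= M -> exists n, forall X, X < k -> A X ->
      0 < X -> forall w, A w -> n <= w ->
      ~ ev2 (fun b t => rowpick (lam X) (mu w) b t = w).
    elim=> [|k IH] kM; first by exists 0.
    have [n Hn] := IH (ltnW kM).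
    case: (classic (A k /\ 0 < k)) => [[Ak k0]|nk]; last first.
      by exists n => X; rewrite ltnS leq_eqVlt => /orP[/eqP-> ? ?|]; [case: nk | exact: Hn].
    have [n' Hn'] : exists n', forall w, A w -> n' <= w ->
        ~ ev2 (fun b t => rowpick (lam k) (mu w) b t = w).
      apply: NNPP => C'; apply: C; exists k; split => // n'.
      apply: NNPP => C''; apply: C'; exists n' => w Aw le ev; apply: C''; by exists w.
    exists (maxn n n') => X; rewrite ltnS leq_eqVlt => /orP[/eqP-> _ _ w Aw|lt AX X0 w Aw];
      rewrite geq_max => /andP[l1 l2]; [exact: Hn' | exact: Hn].
  have [w Aw [l1 _ l3]] := elt (maxn (maxn n M) 1).
  move: l1 l3; rewrite !geq_max => /andP[/andP[l1 l2] l3] /andP[/andP[_ l4] _].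
  have [X [[AX X0 XM] ev]] := HM w Aw l3 l4.
  exact: Hn XM AX X0 w Aw l1 ev.
have far n : exists2 N, n < N & forall y, A y -> N <= y -> n < lam y.
  by have [N HN] := lam_unbounded n.+1; exists (maxn N n.+1) => [|y Ay];
     rewrite ?leq_maxr // geq_max => /andP[le _]; exact: HN.
set l := lam X in HX.
(* Each element is chosen far beyond the previous ones; moreover [lam x] exceeds [Bw], and [lam y]
   exceeds both [Bw] and [Bx]. *)
have [Nw _ HNw] := far (mu X); have [w Aw [lew [Bw evw]]] := HX (maxn Nw X.+1).
move: lew; rewrite geq_max => /andP[/(HNw _ Aw) Xw ltXw].
have w0 : 0 < w by lia.
have [Nx _ HNx] := far (maxn (mu w) Bw); have [x Ax [lex [Bx evx]]] := HX (maxn Nx w.+1).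
move: lex; rewrite geq_max => /andP[/(HNx _ Ax) wx ltwx].
have x0 : 0 < x by lia.
have [Ny _ HNy] := far (maxn (maxn (mu x) Bw) Bx); have [y [ley Ay]] := Ainf (maxn Ny x.+1).
move: ley; rewrite geq_max => /andP[/(HNy _ Ay) xy ltxy].
have y0 : 0 < y by lia.
rewrite !gtn_max in wx xy; case/andP: wx => wx Bwx; case/andP: xy => /andP[xy Bwy] Bxy.
(* Inner thresholds for the gaps [(mu w, lam x)], [(mu w, lam y)] and [(mu x, lam y)]; [mu z] is
   then taken at least as large as all three. *)
have [T1 HT1] := evw _ (ltnW Bwx); have [T2 HT2] := evw _ (ltnW Bwy).
have [T3 HT3] := evx _ (ltnW Bxy).
have [z Az [lez lz mz]] := elt (maxn (maxn (mu y).+1 y.+1) (maxn T1 (maxn T2 T3))).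
move: lez lz mz; rewrite !geq_max => /andP[/andP[_ ltyz] _] /andP[/andP[yz _] _]
  /and4P[_ t1 t2 t3].
have z0 : 0 < z by lia.
have ltp := lt_pow_mu.
have row u : 0 < u -> u < 2 ^ (mu u).+1 by case/muP/andP.
have [v Ev] : exists v, v = y + z by exists (y + z).
have v0 : 0 < v by lia.
have lv : lam v = lam y by rewrite Ev; apply: lam_add => //; apply: ltp.
have mv : mu v = mu z by rewrite Ev; apply: mu_add => //; apply: ltp.
have [v1 Ev1] : exists v1, v1 = x + v by exists (x + v).
have lv1 : lam v1 = lam x by rewrite Ev1; apply: lam_add => //; rewrite lv; apply: ltp.
have mv1 : mu v1 = mu z by rewrite Ev1 mu_add // lv; apply: ltp.
have wv : w < 2 ^ lam v by rewrite lv; apply: ltp => //; have := lam_leq_mu x0; lia.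
have wv1 : w < 2 ^ lam v1 by rewrite lv1; apply: ltp.
have v10 : 0 < v1 by lia.
have Xw' : X < 2 ^ lam w by apply: ltp.
have l1 : lam (w + v1) = lam w by apply: lam_add.
have l2 : lam (w + v) = lam w by apply: lam_add.
have m1 : mu (w + v1) = mu z by rewrite mu_add.
have m2 : mu (w + v) = mu z by rewrite mu_add.
have p1' : 0 < w + v1 by lia.
have p2' : 0 < w + v by lia.
have xv : x < 2 ^ lam v by rewrite lv; apply: ltp.
have X1 : X < 2 ^ lam (w + v1) by rewrite l1.
have X2 : X < 2 ^ lam (w + v) by rewrite l2.
have E : color (X + (w + v1)) = color (X + (w + v)).
  apply: color_FS.
    have -> : X + (w + v1) = \sum_(i <- [:: X; w; x; y; z]) i.
      by rewrite !big_cons big_nil addn0 ?Ev1 Ev.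
    apply: FS_sum => // [|i]; first by rewrite /= !inE; lia.
    by rewrite !inE => /or4P[/eqP->|/eqP->|/eqP->|/orP[/eqP->|/eqP->]].
  have -> : X + (w + v) = \sum_(i <- [:: X; w; y; z]) i.
    by rewrite !big_cons big_nil addn0 ?Ev1 Ev.
  apply: FS_sum => // [|i]; first by rewrite /= !inE; lia.
  by rewrite !inE => /or4P[/eqP->|/eqP->|/eqP->|/eqP->].
(* The gap between [X] and [w] has the same weight in both sums, so its pick need not be known. *)
have GL : G l (mu z) (X + (w + v1)) = G l (mu z) X + gap_weight l (mu X) (lam w) (mu z) +
    (G l (mu z) w + (G l (mu z) w).+1 +
      (G l (mu z) x + (G l (mu z) x).+1 + G l (mu z) v)).
  rewrite (G_add l _ X0 p1' X1) l1 (G_add l _ w0 v10 wv1) lv1 Ev1.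
  rewrite (G_add l _ x0 v0 xv) lv /gap_weight (HT1 _ t1) (HT3 _ t3).
  by rewrite (row _ w0) (row _ x0).
have GR : G l (mu z) (X + (w + v)) = G l (mu z) X + gap_weight l (mu X) (lam w) (mu z) +
    (G l (mu z) w + (G l (mu z) w).+1 + G l (mu z) v).
  rewrite (G_add l _ X0 p2' X2) l2 (G_add l _ w0 v0 wv) lv /gap_weight (HT2 _ t2).
  by rewrite (row _ w0).
have c1 : lam (X + (w + v1)) = l by apply: lam_add.
have c2 : lam (X + (w + v)) = l by apply: lam_add.
have c3 : mu (X + (w + v1)) = mu z by rewrite mu_add ?l1.
have c4 : mu (X + (w + v)) = mu z by rewrite mu_add ?l2.
(* The left total exceeds the right one by twice the inner weight of [x] plus one, so the third bits
   differ. *)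
have := color_G E; rewrite c1 c2 c3 c4 GL GR.
move: (G l (mu z) X) (gap_weight _ _ _ _) (G l (mu z) w) (G l (mu z) x) (G l (mu z) v).
by move=> a1 a2 a3 a4 a5; lia.
Qed.
End Solution.

Theorem theorem4p3 :
  exists c : nat -> bool * bool * bool,
    recursive_coloring c /\
    forall A : nat -> Prop, Pi03 A -> infinite_set A -> ~ hindman_solution c A.
Proof.
exists color; split; first exact: recursive_color.
move=> A /Pi03_survives[e Ae] Ainf [_ Amono]; exact (no_solution Ainf Amono Ae).
Qed.
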